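(* Suppose $T$ is NIP, $G$ is dfg, and $t\in S_G^{\mathrm{inv}}(\mathcal{U},M)$ is right dfg over $M$. Then $t*S_G^{\mathrm{inv}}(\mathcal{U},M)$ is an Ellis subgroup of $S_G^{\mathrm{inv}}(\mathcal{U},M)$, its image under $K_M$ is an Ellis subgroup of $S_G^{\mathrm{fs}}(\mathcal{U},M)$, and $K_M|_{t*S_G^{\mathrm{inv}}(\mathcal{U},M)}$ is an anti-isomorphism between them.
   Context: $\mathcal{U}$ monster model of $T$, $M\prec\mathcal{U}$ small, $G$ a group definable over $\emptyset$. $S_G^{\mathrm{inv}}(\mathcal{U},M)$ (resp. $S_G^{\mathrm{fs}}(\mathcal{U},M)$): global types on $G$ which are $M$-invariant (resp. finitely satisfiable in $M$). Newelski product: $\varphi(x,d)\in p*q$ iff $\varphi(x\cdot b,d)\in p$ where $b\models q|_{Md}$; both spaces are compact Hausdorff semigroups. Right translate: $\varphi(x)\in p\cdot c\iff\varphi(x\cdot c)\in p$. $p^{-1}=\mathrm{tp}(a^{-1}/\mathcal{U})$ for $a\models p$. A type is right dfg over $M$ if it and all its right translates by elements of $G(\mathcal{U})$ are definable over $M$; $G$ is dfg if some type is right dfg over $M$. Ellis subgroup: $u*I$ for $I$ a minimal left ideal and $u\in I$ idempotent. Anti-isomorphism: bijection $f$ with $f(ab)=f(b)f(a)$. Retraction $F_M$ (NIP): add predicate $\mathbf{P}$ for $M$, take a $|\mathcal{U}|^+$-saturated $(N',N)\succ(\mathcal{U},M)$; for $M$-invariant $p$ let $p|_N$ be the restriction to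 $N$ of its $M$-invariant extension to $N'$; $\theta(x,b)\in F_M(p)$ iff $\{\theta(x,b),\mathbf{P}(x)\}\cup p|_N$ is consistent. $K_M(p):=F_M(p^{-1})$. *)

(* Defs.v *)
From mathcomp Require Import all_boot.
From mathcomp Require Import boolp classical_sets functions cardinality.

Set Implicit Arguments.
Unset Strict Implicit.
Unset Printing Implicit Defensive.

Local Open Scope classical_set_scope.
Local Open Scope card_scope.

(** * First-order syntax and semantics *)

Record language := Language {
  fsym : Type;
  far : fsym -> nat;
  rsym : Type;
  rar : rsym -> nat }.

Inductive term (L : language) (V : Type) : Type :=
| Tvar of V
| Tapp (f : fsym L) of ('I_(far f) -> term L V).

(* [formula L V]: L-formulas whose free variables are in V; [Fex] binds the
   variable [None].  An L(A)-formula in the variables x_0, ..., x_(n-1) is an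
   element of [formula L ('I_n + A)]. *)
Inductive formula (L : language) (V : Type) : Type :=
| Feq of term L V & term L V
| Frel (r : rsym L) of ('I_(rar r) -> term L V)
| Fnot of formula L V
| Fand of formula L V & formula L V
| Fex of formula L (option V).

Arguments Tvar {L V}.

Definition sentence (L : language) := formula L void.

Fixpoint tren (L : language) (V W : Type) (h : V -> W) (s : term L V) :
    term L W :=
  match s with
  | Tvar v => Tvar (h v)
  | Tapp f args => @Tapp L W f (fun i => tren h (args i))
  end.

Fixpoint fren (L : language) (V W : Type) (h : V -> W) (phi : formula L V) :
    formula L W :=
  match phi with
  | Feq s1 s2 => Feq (tren h s1) (tren h s2)
  | Frel r args => @Frel L W r (fun i => tren h (args i))
  | Fnot psi => Fnot (fren h psi)
  | Fand psi1 psi2 => Fand (fren h psi1) (fren h psi2)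
  | Fex psi => Fex (fren (omap h) psi)
  end.

(* The block of quantifiers "exists z_0 ... z_(n-1)". *)
Fixpoint Fexn (L : language) (n : nat) :
    forall V : Type, formula L (V + 'I_n) -> formula L V :=
  match n with
  | 0 => fun V phi =>
      fren (fun s : V + 'I_0 => match s with
            | inl v => v
            | inr i => False_rect V (notF (ltn_ord i))
            end) phi
  | m.+1 => fun V phi =>
      Fex (Fexn (fren (fun s : V + 'I_m.+1 => match s with
            | inl v => inl (Some v)
            | inr i => if unlift ord0 i is Some i' then inr i' else inl None
            end) phi))
  end.

Record structure (L : language) := Structure {
  carrier :> Type;
  carrier_inhabited : inhabited carrier;
  fint : forall f : fsym L, ('I_(far f) -> carrier) -> carrier;
  rint : forall r : rsym L, ('I_(rar r) -> carrier) -> Prop }.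

Fixpoint teval (L : language) (N : structure L) (V : Type) (v : V -> N)
    (s : term L V) : N :=
  match s with
  | Tvar x => v x
  | Tapp f args => fint (fun i => teval v (args i))
  end.

Definition scons (N V : Type) (c : N) (v : V -> N) (o : option V) : N :=
  if o is Some x then v x else c.

Fixpoint sat (L : language) (N : structure L) (V : Type) (phi : formula L V) :
    (V -> N) -> Prop :=
  match phi with
  | Feq s1 s2 => fun v => teval v s1 = teval v s2
  | Frel r args => fun v => rint (fun i => teval v (args i))
  | Fnot psi => fun v => ~ sat psi v
  | Fand psi1 psi2 => fun v => sat psi1 v /\ sat psi2 v
  | Fex psi => fun v => exists c : N, sat psi (scons c v)
  end.

Definition model_of (L : language) (T : set (sentence L)) (N : structure L) :=
  forall sigma, T sigma -> sat sigma (of_void N).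

Definition elementary (L : language) (N N' : structure L) (j : N -> N') :=
  forall (V : Type) (phi : formula L V) (v : V -> N),
    sat phi v <-> sat phi (j \o v).

Definition elem_substructure (L : language) (N : structure L) (A : set N) :=
  exists (S : structure L) (i : S -> N), elementary i /\ range i = A.

Definition automorphism (L : language) (N : structure L) (s : N -> N) :=
  [/\ bijective s,
      forall (f : fsym L) (a : 'I_(far f) -> N),
        s (fint a) = fint (s \o a) &
      forall (r : rsym L) (a : 'I_(rar r) -> N),
        rint a <-> rint (s \o a)].

(** * Formulas over a structure, partial types *)

Section PartialTypes.
Variables (L : language) (N : structure L) (n : nat).
Implicit Types (phi : formula L ('I_n + N)) (S : set (formula L ('I_n + N))).

Definition holds phi (a : 'I_n -> N) : Prop :=
  sat phi (fun s => match s with inl i => a i | inr c => c end).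

(* phi(x, d), for phi(x, y) without parameters *)
Definition inst (m : nat) (phi : formula L ('I_n + 'I_m)) (d : 'I_m -> N) :
    formula L ('I_n + N) :=
  fren (fun s => match s with inl i => inl i | inr i => inr (d i) end) phi.

Definition over (A : set N) : set (formula L ('I_n + N)) :=
  [set phi | exists (m : nat) (psi : formula L ('I_n + 'I_m)) (d : 'I_m -> N),
      (forall i, A (d i)) /\ phi = inst psi d].

Definition realizes (a : 'I_n -> N) S := forall phi, S phi -> holds phi a.

Definition fin_sat_in (A : set N) S :=
  forall S0, finite_set S0 -> S0 `<=` S ->
    exists a : 'I_n -> N, (forall i, A (a i)) /\ realizes a S0.

Definition complete_type S :=
  fin_sat_in setT S /\ forall phi, S phi \/ S (Fnot phi).

Definition equiv_over (A : set N) (b c : 'I_n -> N) :=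
  forall phi, over A phi -> (holds phi b <-> holds phi c).

End PartialTypes.

(* Saturation with respect to a class [sm] of parameter sets. *)
Definition saturated (L : language) (N : structure L) (sm : set (set N)) :=
  forall A : set N, sm A ->
  forall (n : nat) (S : set (formula L ('I_n + N))),
    S `<=` over A -> fin_sat_in setT S -> exists a, realizes a S.

(** * Monster models, NIP *)

(* |A| < |kappa|; cardinals are represented by types. *)
Definition small (kappa X : Type) (A : set X) : Prop :=
  A #<= [set: kappa] /\ ~ ([set: kappa] #<= A).

Definition strongly_homogeneous (kappa : Type) (L : language)
    (U : structure L) :=
  forall (A : set U) (f : U -> U), small kappa A ->
    (forall (n : nat) (phi : formula L 'I_n) (a : 'I_n -> U),
        (forall i, A (a i)) -> (sat phi a <-> sat phi (f \o a))) ->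
    exists s : U -> U, automorphism s /\ forall x, A x -> s x = f x.

Record monster_model (kappa : Type) (L : language) (T : set (sentence L))
    (U : structure L) : Prop := MonsterModel {
  monster_aleph0 : small kappa [set: nat];
  monster_fsym : small kappa [set: fsym L];
  monster_rsym : small kappa [set: rsym L];
  monster_model_of : model_of T U;
  monster_saturated : saturated (fun A : set U => small kappa A);
  monster_homogeneous : strongly_homogeneous kappa U }.

Definition shattered (L : language) (N : structure L) (m n : nat)
    (phi : formula L ('I_m + 'I_n)) (A : set ('I_m -> N)) :=
  forall B, B `<=` A -> exists b : 'I_n -> N, forall a, A a ->
    (sat phi (fun s => match s with inl i => a i | inr i => b i end) <-> B a).

Definition NIP (L : language) (T : set (sentence L)) :=
  forall N : structure L, model_of T N ->
  forall (m n : nat) (phi : formula L ('I_m + 'I_n)) (A : set ('I_m -> N)),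
    infinite_set A -> ~ shattered phi A.

(** * Invariant and definable types *)

Section Types.
Variables (L : language) (U : structure L) (k : nat).
Implicit Types (A : set U) (p : set (formula L ('I_k + U))).

Definition invariant A p :=
  forall (n : nat) (phi : formula L ('I_k + 'I_n)) (b c : 'I_n -> U),
    equiv_over A b c -> (p (inst phi b) <-> p (inst phi c)).

Definition definable_over A p :=
  forall (n : nat) (phi : formula L ('I_k + 'I_n)),
    exists psi : formula L ('I_n + U), over A psi /\
      forall b : 'I_n -> U, p (inst phi b) <-> holds psi b.

Definition restr A p : set (formula L ('I_k + U)) :=
  [set phi | p phi /\ over A phi].

End Types.

(** * Definable groups *)

(* A group whose universe [gdom] is a 0-definable set of k-tuples and whose
   multiplication has the 0-definable graph [gmul]. *)
Record definable_group (L : language) (U : structure L) (k : nat) :=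
  DefinableGroup {
  gdom : formula L 'I_k;
  gmul : formula L ('I_k + 'I_k + 'I_k);
  inG := fun a : 'I_k -> U => sat gdom a;
  mulG := fun a b c : 'I_k -> U =>
    sat gmul (fun s => match s with
      | inl (inl i) => a i | inl (inr i) => b i | inr i => c i end);
  gmul_fun : forall a b, inG a -> inG b ->
    exists c, inG c /\ forall c', mulG a b c' <-> c' = c;
  gmul_assoc : forall a b c ab bc r s, inG a -> inG b -> inG c ->
    mulG a b ab -> mulG b c bc -> mulG ab c r -> mulG a bc s -> r = s;
  gmul_id_inv : exists e, inG e /\ forall a, inG a ->
    [/\ mulG e a a, mulG a e a &
        exists a', [/\ inG a', mulG a a' e & mulG a' a e]] }.

Section Group.
Variables (L : language) (U : structure L) (k : nat).
Variable G : definable_group U k.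
Implicit Types (M : set U) (p q : set (formula L ('I_k + U))).
Implicit Types (phi : formula L ('I_k + U)).

(* phi(x . b), i.e. exists z, x . b = z /\ phi(z) *)
Definition subst_rmul phi (b : 'I_k -> U) : formula L ('I_k + U) :=
  Fexn (Fand
    (fren (fun s => match s with
       | inl (inl i) => inl (inl i)
       | inl (inr i) => inl (inr (b i))
       | inr i => inr i end) (gmul G))
    (fren (fun s => match s with
       | inl i => inr i
       | inr c => inl (inr c) end) phi)).

(* phi(x^-1), i.e. exists z e, z, e in G /\ e . e = e /\ x . z = e /\ phi(z) *)
Definition subst_inv phi : formula L ('I_k + U) :=
  Fexn (Fexn (Fand
    (Fand (fren (fun i => inl (inr i)) (gdom G))
          (fren (fun i => inr i) (gdom G)))
    (Fand
      (Fand
        (fren (fun s => match s with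
           | inl (inl i) => inr i
           | inl (inr i) => inr i
           | inr i => inr i end) (gmul G))
        (fren (fun s => match s with
           | inl (inl i) => inl (inl (inl i))
           | inl (inr i) => inl (inr i)
           | inr i => inr i end) (gmul G)))
      (fren (fun s => match s with
         | inl i => inl (inr i)
         | inr c => inl (inl (inr c)) end) phi)))).

Definition S_G p := complete_type p /\ p (fren inl (gdom G)).

Definition S_inv M : set (set (formula L ('I_k + U))) :=
  [set p | S_G p /\ invariant M p].

Definition S_fs M : set (set (formula L ('I_k + U))) :=
  [set p | S_G p /\ fin_sat_in M p].

Definition newelski M p q : set (formula L ('I_k + U)) :=
  [set Phi | exists (n : nat) (phi : formula L ('I_k + 'I_n)) (d : 'I_n -> U)
      (b : 'I_k -> U),
      [/\ Phi = inst phi d, realizes b (restr (M `|` range d) q) &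
          p (subst_rmul (inst phi d) b)]].

Definition rtranslate p (c : 'I_k -> U) : set (formula L ('I_k + U)) :=
  [set phi | p (subst_rmul phi c)].

Definition type_inv p : set (formula L ('I_k + U)) :=
  [set phi | p (subst_inv phi)].

Definition right_dfg M p :=
  definable_over M p /\
  forall c : 'I_k -> U, sat (gdom G) c -> definable_over M (rtranslate p c).

Definition dfg_group M := exists p, S_G p /\ right_dfg M p.

End Group.

(** * The retraction F_M and the map K_M *)

Definition lang_pred (L : language) : language :=
  @Language (fsym L) (@far L) (option (rsym L))
    (fun r => if r is Some r' then rar r' else 1).

(* The pair (N, P), as a structure in the language with a unary predicate
   (the symbol [None]) added for P. *)
Definition pair_structure (L : language) (N : structure L) (P : set N) :
    structure (lang_pred L) :=
  @Structure (lang_pred L) N (carrier_inhabited N) (@fint L N)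
    (fun r : option (rsym L) =>
      match r return ('I_(@rar (lang_pred L) r) -> N) -> Prop with
      | Some r' => @rint L N r'
      | None => fun a => P (a ord0)
      end).

Definition saturated_pair_extension (L : language) (U : structure L)
    (M : set U) (N' : structure L) (N : set N') (j : U -> N') :=
  @elementary (lang_pred L) (pair_structure M) (pair_structure N) j /\
  @saturated (lang_pred L) (pair_structure N)
    (fun A : set N' => A #<= [set: U]).

Section Retraction.
Variables (L : language) (U : structure L) (M : set U).
Variables (N' : structure L) (N : set N') (j : U -> N') (k : nat).
Implicit Types (p : set (formula L ('I_k + U))).

Definition push (phi : formula L ('I_k + U)) : formula L ('I_k + N') :=
  fren (fun s => match s with inl i => inl i | inr c => inr (j c) end) phi.

Definition inv_extension p (p' : set (formula L ('I_k + N'))) :=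
  [/\ complete_type p', (forall phi, p phi -> p' (push phi)) &
      invariant (j @` M) p'].

Definition inv_restr p : set (formula L ('I_k + N')) :=
  [set psi | exists p' : set (formula L ('I_k + N')),
      inv_extension p p' /\ restr N p' psi].

(* {theta(x, b), P(x)} together with p|_N is consistent with the elementary
   diagram of (N', N) iff its finite parts are realized in (N', N), i.e. iff
   the finite parts of {theta(x, b)} `|` p|_N are realized by tuples from N. *)
Definition F_map p : set (formula L ('I_k + U)) :=
  [set theta | fin_sat_in N (push theta |` inv_restr p)].

Definition K_map (G : definable_group U k) p := F_map (type_inv G p).

End Retraction.

(** * Ellis subgroups *)

Section Semigroup.
Variables (X : Type) (op : X -> X -> X).

Definition left_ideal (S I : set X) :=
  [/\ I `<=` S, I !=set0 & forall s x, S s -> I x -> I (op s x)].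

Definition minimal_left_ideal (S I : set X) :=
  left_ideal S I /\ forall J, left_ideal S J -> J `<=` I -> J = I.

Definition ellis_subgroup (S H : set X) :=
  exists (I : set X) (u : X),
    [/\ minimal_left_ideal S I, I u, op u u = u & H = [set op u x | x in I]].

Definition anti_isomorphism (H K : set X) (f : X -> X) :=
  set_bij H K f /\
  forall x y, H x -> H y -> f (op x y) = op (f y) (f x).

End Semigroup.

(* Main.v *)
From mathcomp Require Import all_boot.
From mathcomp Require Import boolp classical_sets functions cardinality.
Require Import Defs.

(** A complete type is viewed as an ultrafilter on definable sets.

    If t is right dfg over M, every translate t.c is definable over M, so it
    depends only on tp(c/M); hence t * q = t.c for any c |= q|_M, and
    t * S^inv is the orbit {t.g | g in G(U)}.  Fixing a0 |= t|_M, the product on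
    the orbit is (t.b) * (t.c) = t.(b a0 c), a group law with unit
    u = t.a0^-1.  A right ideal which is a group with unit u is the Ellis
    subgroup u * (S^inv * u).

    For a type r definable over M, membership in F_M(r) is an elementary
    property of the pair (N', N), so it can be read off in (U, M): F_M(r) is
    generated by the traces on M of the formulas of r|_M.  NIP makes it
    complete, i.e. r|_M has a unique coheir.  For s in S^fs and p in the orbit,
    s * K_M(p) and K_M(p.c) with c^-1 |= s|_M are both coheirs of the same type
    over M, so they are equal.  Taking s = K_M(q) gives
    K_M(q) * K_M(p) = K_M(p * q), and arbitrary s shows that the image of the
    orbit is a left ideal; being a group, it is an Ellis subgroup.  Injectivity
    holds because K_M(p) determines p^-1 over M, hence p by definability. *)

Set Implicit Arguments.
Unset Strict Implicit.
Unset Printing Implicit Defensive.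

Local Open Scope classical_set_scope.
Local Open Scope card_scope.


(** Definability is what makes F_M computable. If delta defines psi for r, then psi(x, n) lies in
    r|_N exactly when delta(n) holds. Consistency of theta with psi(x, n) inside P, for all such n,
    then reads: every n in P with delta(n) has some a in P with psi(a, n) and theta(a). This is a
    first-order statement of the pair.

    The order of factors is reversed by K_M for the following reason. The product s * K_M(p) tests
    chi(a.y) with a generic for s and y = x^-1, x generic for p. When a is replaced by c^-1, this
    becomes chi((x.c)^-1), a condition on p.c. That s * K_M(p) and K_M(p.c) agree over M is an
    exchange of generics: s is finitely satisfiable in M, so a may be moved into M, where chi(a.y)
    is an M-formula and K_M(p) agrees with p^-1.

    Two of the definitions involve choices that must be shown harmless: the Newelski product ranges
    over all presentations of a formula and all realizations of q, and r|_N is collected from all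
    invariant extensions of r. *)

Definition join (X V W : Type) (v : V -> X) (w : W -> X) (s : V + W) : X :=
  match s with inl i => v i | inr i => w i end.

Lemma comp_join (X Y V W : Type) (f : X -> Y) (v : V -> X) (w : W -> X) :
  f \o join v w = join (f \o v) (f \o w).
Proof. by apply: funext; case. Qed.

(** * Renaming of variables *)

Section Renaming.
Variable L : language.

Lemma tren_comp (V W Z : Type) (h : V -> W) (g : W -> Z) (s : term L V) :
  tren g (tren h s) = tren (g \o h) s.
Proof.
by elim: s => [x|f args IH] //=; congr Tapp; apply: funext => i; exact: IH.
Qed.

Lemma omap_comp (V W Z : Type) (h : V -> W) (g : W -> Z) :
  omap g \o omap h = omap (g \o h).
Proof. by apply: funext; case. Qed.

Lemma fren_comp (V W Z : Type) (h : V -> W) (g : W -> Z) (phi : formula L V) :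
  fren g (fren h phi) = fren (g \o h) phi.
Proof.
elim: phi W Z h g => {V} /=.
- by move=> V s1 s2 W Z h g; rewrite !tren_comp.
- by move=> V r args W Z h g; congr Frel; apply: funext => i; exact: tren_comp.
- by move=> V psi IH W Z h g; rewrite IH.
- by move=> V psi1 IH1 psi2 IH2 W Z h g; rewrite IH1 IH2.
- by move=> V psi IH W Z h g; rewrite IH omap_comp.
Qed.

Lemma tren_id (V : Type) (s : term L V) : tren id s = s.
Proof.
by elim: s => [x|f args IH] //=; congr Tapp; apply: funext => i; exact: IH.
Qed.

Lemma fren_id (V : Type) (phi : formula L V) : fren id phi = phi.
Proof.
elim: phi => {V} /=.
- by move=> V s1 s2; rewrite !tren_id.
- by move=> V r args; congr Frel; apply: funext => i; exact: tren_id.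
- by move=> V psi ->.
- by move=> V psi1 -> psi2 ->.
- move=> V psi IH; rewrite (_ : omap id = id) ?IH //.
  by apply: funext; case.
Qed.

Lemma teval_tren (N : structure L) (V W : Type) (h : V -> W) (v : W -> N)
  (s : term L V) : teval v (tren h s) = teval (v \o h) s.
Proof.
by elim: s => [x|f args IH] //=; congr fint; apply: funext => i; exact: IH.
Qed.

Lemma sat_fren (N : structure L) (V W : Type) (h : V -> W) (v : W -> N)
  (phi : formula L V) : sat (fren h phi) v = sat phi (v \o h).
Proof.
elim: phi W h v => {V} /=.
- by move=> V s1 s2 W h v; rewrite !teval_tren.
- move=> V r args W h v; congr rint; apply: funext => i; exact: teval_tren.
- by move=> V psi IH W h v; rewrite IH.
- by move=> V psi1 IH1 psi2 IH2 W h v; rewrite IH1 IH2.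
- move=> V psi IH W h v; congr ex; apply: funext => c; rewrite IH.
  by congr sat; apply: funext; case.
Qed.

Lemma sat_Fand (N : structure L) (V : Type) (phi psi : formula L V)
  (v : V -> N) : sat (Fand phi psi) v = (sat phi v /\ sat psi v).
Proof. by []. Qed.

Lemma sat_Fnot (N : structure L) (V : Type) (phi : formula L V) (v : V -> N) :
  sat (Fnot phi) v = ~ sat phi v.
Proof. by []. Qed.

Lemma sat_Fexn (N : structure L) (n : nat) (V : Type)
    (phi : formula L (V + 'I_n)) (v : V -> N) :
  sat (Fexn phi) v <-> exists a : 'I_n -> N, sat phi (join v a).
Proof.
elim: n V phi v => [|n IH] V phi v /=.
  have E a : v \o (fun s : V + 'I_0 => match s with
            | inl v => v
            | inr i => False_rect V (notF (ltn_ord i))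
            end) = join v a.
    by apply: funext; case => // -[].
  rewrite sat_fren; split=> [H|[a]]; last by rewrite (E a).
  by exists (fun i : 'I_0 => False_rect N (notF (ltn_ord i))); rewrite -E.
split=> [[c /IH[a]]|[a H]].
  rewrite sat_fren => H.
  exists (fun i => if unlift ord0 i is Some i' then a i' else c).
  congr (sat phi _): H; apply: funext; case=> //= i.
  by case: (unlift ord0 i).
exists (a ord0); apply/IH; exists (a \o lift ord0); rewrite sat_fren.
congr (sat phi _): H; apply: funext; case=> //= i.
by case: unliftP => [l ->|->].
Qed.

(* The variables of a formula lie in the range of some [c : P -> V] with [P]
   finite: a renaming only depends on its values there. *)
Lemma tren_support (V : Type) (s : term L V) :
  exists (P : finType) (c : P -> V), forall (W : Type) (h h' : V -> W),
    (forall i, h (c i) = h' (c i)) -> tren h s = tren h' s.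
Proof.
elim: s => [x|f args IH].
  by exists unit, (fun=> x) => W h h' /= ->.
have {}IH i : exists y : {P : finType & P -> V}, forall (W : Type)
    (h h' : V -> W), (forall i, h (projT2 y i) = h' (projT2 y i)) ->
    tren h (args i) = tren h' (args i).
  by have [P [c Pc]] := IH i; exists (existT (fun P : finType => P -> V) P c).
have [y Py] := choice IH.
exists {i : 'I_(far f) & projT1 (y i)}.
exists (fun x => projT2 (y (tag x)) (tagged x)) => W h h' E /=.
congr Tapp; apply: funext => i; apply: Py => l.
exact: (E (Tagged (fun i => projT1 (y i)) l)).
Qed.

Lemma fren_support (V : Type) (phi : formula L V) :
  exists (P : finType) (c : P -> V), forall (W : Type) (h h' : V -> W),
    (forall i, h (c i) = h' (c i)) -> fren h phi = fren h' phi.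
Proof.
elim: phi => {V} /=.
- move=> V s1 s2; have [P1 [c1 H1]] := tren_support s1.
  have [P2 [c2 H2]] := tren_support s2.
  exists (P1 + P2)%type, (join c1 c2) => W h h' E.
  by rewrite (H1 _ h h') ?(H2 _ h h') // => i;
    [exact: (E (inr i))|exact: (E (inl i))].
- move=> V r args.
  have /choice[y Py] i : exists y : {P : finType & P -> V}, forall (W : Type)
      (h h' : V -> W), (forall i, h (projT2 y i) = h' (projT2 y i)) ->
      tren h (args i) = tren h' (args i).
    have [P [c Pc]] := tren_support (args i).
    by exists (existT (fun P : finType => P -> V) P c).
  exists {i : 'I_(rar r) & projT1 (y i)}.
  exists (fun x => projT2 (y (tag x)) (tagged x)) => W h h' E /=.
  congr Frel; apply: funext => i; apply: Py => l.
  exact: (E (Tagged (fun i => projT1 (y i)) l)).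
- move=> V psi [P [c H]]; exists P, c => W h h' /H.
  by move=> ->.
- move=> V psi1 [P1 [c1 H1]] psi2 [P2 [c2 H2]].
  exists (P1 + P2)%type, (join c1 c2) => W h h' E.
  by rewrite (H1 _ h h') ?(H2 _ h h') // => i;
    [exact: (E (inr i))|exact: (E (inl i))].
- move=> V psi [P [c H]].
  (* Every [omap h] fixes the bound variable [None], so its place in the support may hold any
     default [v0]; if [V] is empty, all renamings from it coincide. *)
  have [[v0]|V0] := pselect (inhabited V); last first.
    exists void, (of_void V) => W h h' _; congr (Fex (fren (omap _) psi)).
    by apply: funext => v; case: V0; exists.
  exists P, (fun i => odflt v0 (c i)) => W h h' E.
  rewrite (H _ (omap h) (omap h')) // => i.
  by have := E i; case: (c i) => //= v ->.
Qed.
End Renaming.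

(** * Predicates definable with parameters *)

Section Definable.
Variables (L : language) (U : structure L).
Implicit Types A B : set U.

Lemma holds_inst n m (psi : formula L ('I_n + 'I_m)) (d : 'I_m -> U) a :
  holds (inst psi d) a = sat psi (join a d).
Proof.
by rewrite /holds /inst sat_fren; congr sat; apply: funext; case.
Qed.

(** Variables come from any type and parameters from any finite type, so that closure under
    connectives and quantifiers only forms sums of index types; ordinals reappear in [Def_over], at
    the boundary with [over]. *)
Definition Def A (V : Type) (X : (V -> U) -> Prop) : Prop :=
  exists (P : finType) (psi : formula L (V + P)) (d : P -> U),
    (forall i, A (d i)) /\ forall v, X v <-> sat psi (join v d).

Lemma over_fren A n (P : finType) (psi : formula L ('I_n + P)) (d : P -> U) :
  (forall i, A (d i)) -> over A (fren (join inl (inr \o d)) psi).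
Proof.
move=> Ad; exists #|P|, (fren (join inl (inr \o enum_rank)) psi).
exists (d \o enum_val); split=> [i|]; first exact: Ad.
rewrite /inst fren_comp; congr fren; apply: funext; case=> //= i.
by rewrite enum_rankK.
Qed.

Lemma Def_over A n (X : ('I_n -> U) -> Prop) :
  Def A X <-> exists phi, over A phi /\ forall a, X a <-> holds phi a.
Proof.
split=> [[P [psi [d [Ad HX]]]]|[_ [[m [psi [d [Ad ->]]]] HX]]].
  exists (fren (join inl (inr \o d)) psi); split; first exact: over_fren.
  move=> a; rewrite HX /holds sat_fren.
  suff -> : join a d = (fun s => match s with inl i => a i | inr c => c end) \o
    join inl (inr \o d) by [].
  by apply: funext; case.
exists 'I_m, psi, d; split=> // a; rewrite HX holds_inst.
by [].
Qed.

(** By [fren_support] a formula mentions finitely many variables, so its parameters fit in one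
    finite tuple; the index [None] absorbs those outside the support. *)
Lemma over_setT n (phi : formula L ('I_n + U)) : over setT phi.
Proof.
have [u0] := carrier_inhabited U.
have [P [c Hc]] := fren_support phi.
pose d (o : option P) := if o is Some i then
  if c i is inr u then u else u0 else u0.
pose r (s : 'I_n + U) : 'I_n + option P := match s with
  | inl i => inl i
  | inr u => if pselect (exists o, d o = u) is left E
             then inr (projT1 (cid E)) else inr None end.
have -> : phi = fren (join inl (inr \o d)) (fren r phi).
  rewrite fren_comp -[LHS]fren_id; apply: Hc => i /=.
  case E : (c i) => [//|u] /=.
  case: pselect => [e|[]]; last by exists (Some i); rewrite /d E.
  by case: cid => o /= ->.
by apply: over_fren.
Qed.

Lemma Def_holds n (phi : formula L ('I_n + U)) : Def setT (holds phi).
Proof. by apply/Def_over; exists phi; split; first exact: over_setT. Qed.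

Section Closure.
Variable A : set U.

Lemma Def_sub B V (X : (V -> U) -> Prop) : A `<=` B -> Def A X -> Def B X.
Proof.
move=> AB [P [psi [d [Ad HX]]]]; exists P, psi, d; split=> // i.
by apply: AB.
Qed.

Lemma Def_ext V (X Y : (V -> U) -> Prop) :
  (forall v, X v <-> Y v) -> Def A X -> Def A Y.
Proof.
move=> XY [P [psi [d [Ad HX]]]]; exists P, psi, d; split=> // v.
by rewrite -XY.
Qed.

Lemma Def_sat V (phi : formula L V) : Def A (fun v => sat phi v).
Proof.
exists void, (fren inl phi), (of_void U); split=> [[]|v].
by rewrite sat_fren.
Qed.

Lemma Def_not V (X : (V -> U) -> Prop) : Def A X -> Def A (fun v => ~ X v).
Proof.
move=> [P [psi [d [Ad HX]]]]; exists P, (Fnot psi), d; split=> // v /=.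
by rewrite HX.
Qed.

Lemma Def_and V (X Y : (V -> U) -> Prop) :
  Def A X -> Def A Y -> Def A (fun v => X v /\ Y v).
Proof.
move=> [P [psi [d [Ad HX]]]] [Q [chi [e [Ae HY]]]].
exists (P + Q)%type, (Fand (fren (join inl (inr \o inl)) psi)
  (fren (join inl (inr \o inr)) chi)), (join d e); split=> [[]//|v /=].
by rewrite !sat_fren !comp_join HX HY.
Qed.

Lemma Def_imp V (X Y : (V -> U) -> Prop) :
  Def A X -> Def A Y -> Def A (fun v => X v -> Y v).
Proof.
move=> DX /Def_not DY; apply: Def_ext (Def_not (Def_and DX DY)) => v.
split=> [H Xv|H [/H Yv]//]; exact: contrapT (fun nY => H (conj Xv nY)).
Qed.

Lemma Def_iff V (X Y : (V -> U) -> Prop) :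
  Def A X -> Def A Y -> Def A (fun v => X v <-> Y v).
Proof. by move=> DX DY; apply: Def_and; apply: Def_imp. Qed.

Lemma Def_pre V W (h : V -> W) (X : (V -> U) -> Prop) :
  Def A X -> Def A (fun w : W -> U => X (w \o h)).
Proof.
move=> [P [psi [d [Ad HX]]]].
exists P, (fren (join (inl \o h) inr) psi), d; split=> // w.
by rewrite sat_fren comp_join HX.
Qed.

Lemma Def_ex V n (X : (V + 'I_n -> U) -> Prop) :
  Def A X -> Def A (fun v => exists a, X (join v a)).
Proof.
move=> [P [psi [d [Ad HX]]]].
pose g := join (join (inl \o inl) inr) (inl \o inr) :
  (V + 'I_n) + P -> (V + P) + 'I_n.
exists P, (Fexn (fren g psi)), d; split=> // v.
rewrite sat_Fexn; split=> -[a H]; exists a; move: H;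
  rewrite HX sat_fren !comp_join; congr sat; apply: funext; case=> // -[] //.
Qed.

Lemma Def_all V n (X : (V + 'I_n -> U) -> Prop) :
  Def A X -> Def A (fun v => forall a, X (join v a)).
Proof.
move=> DX; apply: Def_ext (Def_not (Def_ex (Def_not DX))) => v.
split=> [H a|H [a] /(_ (H a))//].
by apply: contrapT => nX; apply: H; exists a.
Qed.

Lemma Def_par V (W : finType) (X : (V + W -> U) -> Prop) (d : W -> U) :
  (forall i, A (d i)) -> Def A X -> Def A (fun v => X (join v d)).
Proof.
move=> Ad [P [psi [e [Ae HX]]]].
exists (W + P)%type, (fren (join (join inl (inr \o inl)) (inr \o inr)) psi).
exists (join d e); split=> [[]//|v].
by rewrite HX sat_fren !comp_join.
Qed.
End Closure.

(** Parameters coming from [d] become variables. The places they vacate in [e] still need values in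
    [A], and [m0] supplies them. *)
Lemma Def_unpar A V (W : finType) (d : W -> U) (X : (V -> U) -> Prop) :
  A !=set0 -> Def (A `|` range d) X ->
  exists Y : (V + W -> U) -> Prop, Def A Y /\ forall v, X v <-> Y (join v d).
Proof.
move=> [m0 Am0] [P [psi [e [Ae HX]]]].
have /choice[f Hf] i : exists o : option W, if o is Some w then d w = e i
    else A (e i).
  by case: (Ae i) => [H|[w _ H]]; [exists None|exists (Some w)].
pose g i : (V + W) + P := if f i is Some w then inl (inr w) else inr i.
pose e' i := if f i is Some w then m0 else e i.
exists (fun v => sat (fren (join (inl \o inl) g) psi) (join v e')); split.
  exists P, (fren (join (inl \o inl) g) psi), e'; split=> // i.
  by rewrite /e'; have := Hf i; case: (f i).
move=> v; rewrite HX sat_fren comp_join.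
suff -> : join (join v d) e' \o g = e by [].
apply: funext => i /=; have := Hf i; rewrite /g.
by case E : (f i) => [w|] //= _; rewrite /e' E.
Qed.

Lemma equiv_overP A n (b c : 'I_n -> U) : equiv_over A b c <->
  forall X, Def A X -> (X b <-> X c).
Proof.
split=> [H X /Def_over[phi [Aphi HX]]|H phi Aphi].
  by rewrite !HX; exact: H.
by apply: H; apply/Def_over; exists phi.
Qed.

Definition eqv A (V : Type) (b c : V -> U) :=
  forall X, Def A X -> (X b <-> X c).

Lemma eqv_refl A V (b : V -> U) : eqv A b b.
Proof. by []. Qed.

Lemma eqv_sym A V (b c : V -> U) : eqv A b c -> eqv A c b.
Proof. by move=> H X DX; have [] := H X DX. Qed.

End Definable.

(** * Complete types as ultrafilters of definable sets *)

(** Read [P i x] as: condition [i] takes care of [x]. This reduces finite satisfiability of a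
    directed family to one member at a time. *)
Lemma finite_set_directed (T I : Type) (P : I -> T -> Prop) (i0 : I)
    (S0 : set T) :
  (forall i j, exists l, forall x, P i x \/ P j x -> P l x) ->
  finite_set S0 -> (forall x, S0 x -> exists i, P i x) ->
  exists i, forall x, S0 x -> P i x.
Proof.
move=> dir [n]; elim: n S0 => [|n IH] S0.
  by rewrite II0 card_eq0 => /eqP-> _; exists i0.
move=> /eq_cardSP[x S0x /IH{}IH] H.
have [|i Hi] := IH; first by move=> y [/H].
have [j Hj] := H _ S0x; have [l Hl] := dir i j.
exists l => y S0y; apply: Hl.
have [->|yx] := pselect (y = x); first by right.
by left; apply: Hi.
Qed.

Section Most.
Variables (L : language) (U : structure L) (k : nat).
Implicit Types (p q : set (formula L ('I_k + U))) (X Y : ('I_k -> U) -> Prop).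
Implicit Types (A : set U).

Lemma fin_sat_in_directed A p :
  p !=set0 ->
  (forall phi psi, p phi -> p psi ->
     exists chi, p chi /\ forall a, holds chi a -> holds phi a /\ holds psi a) ->
  (forall phi, p phi -> exists a, (forall i, A (a i)) /\ holds phi a) ->
  fin_sat_in A p.
Proof.
move=> [phi0 pphi0] dir ne S0 finS0 S0p.
pose P (phi : {phi | p phi}) psi := forall a, holds (sval phi) a -> holds psi a.
have [||[phi pphi] Hphi] := @finite_set_directed _ _ P (exist _ _ pphi0) S0 _ finS0.
- move=> [phi pphi] [psi ppsi]; have [chi [pchi Hchi]] := dir _ _ pphi ppsi.
  by exists (exist _ _ pchi) => x [] /= H a /Hchi[H1 H2]; apply: H.
- by move=> phi /S0p pphi; exists (exist _ _ pphi).
have [a [Aa Ha]] := ne _ pphi.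
by exists a; split=> // psi /Hphi; apply.
Qed.

Lemma complete_type_directed p :
  (forall phi psi, p phi -> p psi ->
     exists chi, p chi /\ forall a, holds chi a -> holds phi a /\ holds psi a) ->
  (forall phi, p phi -> exists a, holds phi a) ->
  (forall phi, p phi \/ p (Fnot phi)) ->
  complete_type p.
Proof.
move=> dir ne dec; split=> //; apply: fin_sat_in_directed => //.
  have [u0] := carrier_inhabited U.
  pose phi0 : formula L ('I_k + U) := Feq (Tvar (inr u0)) (Tvar (inr u0)).
  by have [H|H] := dec phi0; eexists; exact: H.
by move=> phi /ne[a Ha]; exists a.
Qed.

(* [X] need not be definable here. *)
Definition most p X := exists phi, p phi /\ forall a, holds phi a -> X a.

Lemma most_mono p X Y : (forall a, X a -> Y a) -> most p X -> most p Y.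
Proof. by move=> XY [phi [pphi H]]; exists phi; split=> // a /H/XY. Qed.

Lemma most_iff p X Y : (forall a, X a <-> Y a) -> (most p X <-> most p Y).
Proof. by move=> XY; split; apply: most_mono => a; rewrite XY. Qed.

Section Complete.
Variable p : set (formula L ('I_k + U)).
Hypothesis cp : complete_type p.

Lemma complete_ex3 phi psi chi : p phi -> p psi -> p chi ->
  exists a, [/\ holds phi a, holds psi a & holds chi a].
Proof.
move=> Hphi Hpsi Hchi.
have [||a [_ Ha]] := cp.1 [set phi; psi; chi]; first exact: finite_set3.
  by move=> _ [[]|] ->.
by exists a; split; apply: Ha; [left; left|left; right|right].
Qed.

Lemma mostE phi : p phi <-> most p (holds phi).
Proof.
split=> [H|[psi [ppsi H]]]; first by exists phi.
have [//|nphi] := cp.2 phi.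
by have [a [/H]] := complete_ex3 ppsi nphi nphi.
Qed.

Lemma complete_and phi psi : p phi -> p psi -> p (Fand phi psi).
Proof.
move=> H1 H2; have [//|H3] := cp.2 (Fand phi psi).
by have [a [h1 h2 []]] := complete_ex3 H1 H2 H3.
Qed.

Lemma most_and X Y : most p X -> most p Y -> most p (fun a => X a /\ Y a).
Proof.
move=> [phi [pphi HX]] [psi [ppsi HY]].
exists (Fand phi psi); split; first exact: complete_and.
by move=> a [/HX ? /HY].
Qed.

Lemma most_ex X : most p X -> exists a, X a.
Proof.
move=> [phi [pphi H]].
by have [a [/H]] := complete_ex3 pphi pphi pphi; exists a.
Qed.

Lemma most_not X : Def setT X -> (most p (fun a => ~ X a) <-> ~ most p X).
Proof.
move=> /Def_over[phi [_ HX]]; split=> [H1 H2|H].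
  by have [a []] := most_ex (most_and H1 H2).
have [pphi|nphi] := cp.2 phi.
  by case: H; exists phi; split=> // a; rewrite HX.
by exists (Fnot phi); split=> // a; rewrite HX.
Qed.

Lemma most_cst (Q : Prop) : most p (fun=> Q) <-> Q.
Proof.
split=> [/most_ex[]//|q].
have [u0] := carrier_inhabited U.
pose tau : formula L ('I_k + U) := Feq (Tvar (inr u0)) (Tvar (inr u0)).
by have [H|H] := cp.2 tau; eexists; (split; first exact: H).
Qed.

Lemma complete_type_eq q : complete_type q ->
  (forall phi, p phi -> q phi) -> p = q.
Proof.
move=> cq pq; apply/predeqP => phi; split=> [/pq//|qphi].
have [//|/pq nphi] := cp.2 phi.
have [||a [_ Ha]] := cq.1 [set phi; Fnot phi]; first exact: finite_set2.
  by move=> _ [] ->.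
by case: (Ha (Fnot phi)); [right|apply: Ha; left].
Qed.

(* Moves the parameters of a relation into the second block of variables. *)
Lemma relation_inst A (V : finType) (R : ('I_k + V -> U) -> Prop) :
  Def A R -> exists (P : finType) (phi : formula L ('I_k + 'I_#|{: V + P}|))
    (e : P -> U), (forall i, A (e i)) /\ forall v,
      p (inst phi (join v e \o enum_val)) <-> most p (fun a => R (join a v)).
Proof.
move=> [P [psi [e [Ae HR]]]].
pose g : ('I_k + V) + P -> 'I_k + 'I_#|{: V + P}| := join
  (join inl (inr \o enum_rank \o inl)) (inr \o enum_rank \o inr).
exists P, (fren g psi), e; split=> // v.
rewrite mostE; apply: most_iff => a; rewrite holds_inst HR sat_fren.
rewrite (_ : join a _ \o g = join (join a v) e) //.
by apply: funext; case=> [[]|] //= i; rewrite enum_rankK.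
Qed.

(** The definition scheme of [p] covers parameter-free formulas only; the parameters of [R] are
    therefore treated as variables, and substituted back into the defining formula. *)
Lemma Def_most A (V : finType) (R : ('I_k + V -> U) -> Prop) :
  definable_over A p -> Def A R ->
  Def A (fun v => most p (fun a => R (join a v))).
Proof.
move=> defp /relation_inst[P [phi [e [Ae HR]]]].
have [delta [Adelta Hdelta]] := defp _ phi.
have Dd : Def A (holds delta) by apply/Def_over; exists delta.
apply: Def_ext (Def_par Ae (Def_pre (@enum_val (V + P)%type _) Dd)) => v /=.
by rewrite -HR Hdelta.
Qed.

Lemma most_eqv A (V : finType) (R : ('I_k + V -> U) -> Prop) b c :
  invariant A p -> Def A R -> eqv A b c ->
  most p (fun a => R (join a b)) -> most p (fun a => R (join a c)).
Proof.
move=> invp /relation_inst[P [phi [e [Ae HR]]]] bc.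
rewrite -!HR => H; apply: (iffLR (invp _ phi _ _ _)) H.
apply/equiv_overP => X DX.
exact: bc (Def_par Ae (Def_pre (@enum_val (V + P)%type _) DX)).
Qed.

(** Realization of the restriction of [p] to [A], stated without formulas; see [realizesP]. *)
Definition rz A b := forall X, Def A X -> most p X -> X b.

Lemma rzP A b X : rz A b -> Def A X -> (X b <-> most p X).
Proof.
move=> rb DX; split=> [Xb|]; last exact: rb.
apply: contrapT => /most_not H; apply: (rb _ (Def_not DX)) => //.
by apply: H; apply: Def_sub DX.
Qed.

Lemma realizesP A b : realizes b (restr A p) <-> rz A b.
Proof.
split=> [H X /Def_over[phi [Aphi HX]] mX|H phi [pphi Aphi]].
  apply/HX; apply: H; split=> //; apply/mostE.
  by apply: most_mono mX => a; rewrite HX.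
by apply: H; [apply/Def_over; exists phi|apply/mostE].
Qed.

Lemma rz_sub A B b : A `<=` B -> rz B b -> rz A b.
Proof. by move=> AB H X DX; apply: H; apply: Def_sub DX. Qed.

Lemma rz_ex (sm : set (set U)) A : saturated sm -> sm A -> exists b, rz A b.
Proof.
move=> sat smA; have [||b /realizesP] := sat _ smA _ (restr A p); last by exists b.
  by move=> phi [].
by move=> S0 finS0 S0p; apply: cp.1 => // phi /S0p[].
Qed.

End Complete.

Lemma definable_invariant A p : definable_over A p -> invariant A p.
Proof.
move=> defp n phi b c bc; have [psi [Apsi H]] := defp _ phi.
by rewrite !H; apply: bc.
Qed.

Lemma fin_sat_ex A p X : complete_type p -> fin_sat_in A p -> most p X ->
  exists a, (forall i, A (a i)) /\ X a.
Proof.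
move=> cp fs [phi [pphi HX]].
have [||a [Aa Ha]] := fs [set phi]; first exact: finite_set1.
  by move=> _ ->.
by exists a; split=> //; apply: HX; apply: Ha.
Qed.

(** Were phi(x, d) and the negation of phi(x, e) both in [p], a tuple of [A] would satisfy both and
    so separate [d] from [e] over [A]. *)
Lemma fin_sat_invariant A p : complete_type p -> fin_sat_in A p -> invariant A p.
Proof.
move=> cp fs n phi b c bc.
suff H (d e : 'I_n -> U) : equiv_over A d e -> p (inst phi d) -> p (inst phi e).
  by split; apply: H => // psi Apsi; rewrite bc.
move=> {b c bc} de pd; have [//|pe] := cp.2 (inst phi e).
have := most_and cp (iffLR (mostE cp _) pd) (iffLR (mostE cp _) pe).
move=> /(fin_sat_ex cp fs)[a [Aa [H1 H2]]].
case: (H2 : ~ holds (inst phi e) a); move: H1; rewrite !holds_inst.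
have D : Def A (fun v => sat phi (join a v)).
  pose g : 'I_k + 'I_n -> 'I_n + 'I_k := join inr inl.
  have := Def_par Aa (Def_sat A (fren g phi)).
  by apply: Def_ext => v; rewrite sat_fren comp_join.
by have /equiv_overP/(_ _ D) := de; case.
Qed.

End Most.

(** * Cardinality of small parameter sets *)

Section Smallness.
Variables (kappa : Type).

Lemma countable_small (T : Type) (A : set T) :
  small kappa [set: nat] -> countable A -> small kappa A.
Proof.
move=> [H1 H2] H; split; first exact: card_le_trans H H1.
by move=> H3; apply: H2; apply: card_le_trans H3 H.
Qed.

(** Hilbert's hotel: along an injective sequence [f] in an infinite [A], the map [h] sends even
    places onto the whole sequence and odd places onto [d], so the image of [A] covers both sets. *)
Lemma small_setU (T : Type) (A : set T) (V : finType) (d : V -> T) :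
  small kappa [set: nat] -> small kappa A -> small kappa (A `|` range d).
Proof.
move=> smN smA; have [finA|infA] := pselect (finite_set A).
  apply: countable_small => //; apply: finite_set_countable.
  by rewrite finite_setU; split=> //; apply: finite_image; apply: finite_finset.
have [[v0]|V0] := pselect (inhabited V); last first.
  rewrite (_ : range d = set0) ?setU0 //.
  by apply/seteqP; split=> // x [v]; case: V0; exists.
have /infiniteP/card_leP/injfunPex[f' _ f'inj] := infA.
pose f n : T := set_val (f' (SigSub (mem_set (I : setT n)))).
have fA n : A (f n) by apply: set_mem; exact: valP.
have finj m n : f m = f n -> m = n.
  by move=> /val_inj/f'inj E; have := congr1 val (E (mem_set I) (mem_set I)).
pose h x := if pselect (exists n, f n = x) is left E then
  let n := projT1 (cid E) in
  if odd n then d (nth v0 (enum V) n./2) else f n./2 else x.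
have hf n : h (f n) = if odd n then d (nth v0 (enum V) n./2) else f n./2.
  rewrite /h; case: pselect => [E|[]]; last by exists n.
  by case: cid => m /= /finj ->.
have sub : A `|` range d `<=` h @` A.
  move=> x [Ax|[v _ <-]].
    have [[n E]|nE] := pselect (exists n, f n = x).
      exists (f n.*2); first exact: fA.
      by rewrite hf odd_double doubleK.
    by exists x => //; rewrite /h; case: pselect.
  exists (f (enum_rank v).*2.+1); first exact: fA.
  by rewrite hf /= odd_double uphalf_double nth_enum_rank.
have H : A `|` range d #<= A.
  exact: card_le_trans (subset_card_le sub) (card_image_le _ _).
case: smA => A1 A2; split; first exact: card_le_trans H A1.
by move=> H'; apply: A2; apply: card_le_trans H' H.
Qed.

End Smallness.

(** * The Tarski-Vaught property of M *)

Section ElementarySubstructure.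
Variables (L : language) (U : structure L) (M : set U).
Hypothesis HM : elem_substructure M.

Lemma elem_substructure_nonempty : M !=set0.
Proof.
have [S [i [_ <-]]] := HM; have [s] := carrier_inhabited S.
by exists (i s), s.
Qed.

Lemma Tarski_Vaught n (X : ('I_n -> U) -> Prop) :
  Def M X -> (exists a, X a) -> exists a, (forall i, M (a i)) /\ X a.
Proof.
move=> [P [psi [d [Md HX]]]] [a /HX Xa].
have [S [f [ef rf]]] := HM.
have /choice[d' Hd'] i : exists s, f s = d i.
  by have := Md i; rewrite -rf => -[s _ <-]; exists s.
have Ed : d = f \o d' by apply: funext => i; rewrite /= Hd'.
have : sat (Fexn (fren (join inr inl) psi)) (f \o d').
  by apply/sat_Fexn; exists a; rewrite sat_fren comp_join -Ed.
move=> /ef/sat_Fexn[c]; rewrite sat_fren comp_join => /ef H.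
exists (f \o c); split=> [i|]; first by rewrite -rf; exists (c i).
by apply/HX; rewrite Ed -comp_join.
Qed.

Lemma Tarski_Vaught_all n (X : ('I_n -> U) -> Prop) :
  Def M X -> (forall a, (forall i, M (a i)) -> X a) -> forall a, X a.
Proof.
move=> DX H a; apply: contrapT => nX.
have [|b [Mb]] := Tarski_Vaught (Def_not DX); first by exists a.
by case; apply: H.
Qed.
End ElementarySubstructure.

(** * The group operations *)

Section GroupLaws.
Variables (L : language) (U : structure L) (k : nat) (G : definable_group U k).
Implicit Types (a b c : 'I_k -> U) (Y : ('I_k -> U) -> Prop) (A : set U).

(** The graph [mulG] lives on all k-tuples, inside the group or not. Choice turns it into a total
    function with the junk value [a], and the group laws are available under [inG] only. *)
Definition gm a b : 'I_k -> U :=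
  if pselect (exists c, inG G c /\ forall c', mulG G a b c' <-> c' = c) is left E
  then projT1 (cid E) else a.

Definition ge : 'I_k -> U := projT1 (cid (gmul_id_inv G)).

Definition gi a : 'I_k -> U :=
  if pselect (exists a', [/\ inG G a', mulG G a a' ge & mulG G a' a ge]) is left E
  then projT1 (cid E) else a.

Lemma mulGE a b c : inG G a -> inG G b -> (mulG G a b c <-> c = gm a b).
Proof.
move=> Ga Gb; rewrite /gm; case: pselect => [E|]; last first.
  by case; exact: gmul_fun.
by case: cid => d /= [_].
Qed.

Lemma gm_inG a b : inG G a -> inG G b -> inG G (gm a b).
Proof.
move=> Ga Gb; have [c [Gc /(_ c)[_ /(_ erefl)]]] := gmul_fun Ga Gb.
by move=> /(mulGE _ Ga Gb) <-.
Qed.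

Lemma gmA a b c : inG G a -> inG G b -> inG G c ->
  gm a (gm b c) = gm (gm a b) c.
Proof.
move=> Ga Gb Gc; have Gab := gm_inG Ga Gb; have Gbc := gm_inG Gb Gc.
by apply/esym; apply: (@gmul_assoc _ _ _ G a b c (gm a b) (gm b c)) => //;
  apply/mulGE.
Qed.

Lemma ge_inG : inG G ge.
Proof. by rewrite /ge; case: cid => e /= []. Qed.

Lemma gm1l a : inG G a -> gm ge a = a.
Proof.
move=> Ga; apply/esym/mulGE => //; first exact: ge_inG.
by rewrite /ge; case: cid => e /= [_ /(_ a Ga)[]].
Qed.

Lemma gm1r a : inG G a -> gm a ge = a.
Proof.
move=> Ga; apply/esym/mulGE => //; first exact: ge_inG.
by rewrite /ge; case: cid => e /= [_ /(_ a Ga)[]].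
Qed.

Lemma giP a : inG G a -> [/\ inG G (gi a), gm a (gi a) = ge & gm (gi a) a = ge].
Proof.
move=> Ga; rewrite /gi; case: pselect => [E|]; last first.
  by case; rewrite /ge; case: cid => e /= [_ /(_ a Ga)[]].
by case: cid => d /= [Gd H1 H2]; split=> //; apply/esym/mulGE.
Qed.

Lemma gi_inG a : inG G a -> inG G (gi a).
Proof. by case/giP. Qed.

Lemma gmVr a : inG G a -> gm a (gi a) = ge.
Proof. by case/giP. Qed.

Lemma gmVl a : inG G a -> gm (gi a) a = ge.
Proof. by case/giP. Qed.

Lemma gi_unique a b : inG G a -> inG G b -> gm a b = ge -> b = gi a.
Proof.
move=> Ga Gb H; have Gi := gi_inG Ga.
by rewrite -[b]gm1l // -(gmVl Ga) -gmA // H gm1r.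
Qed.

Lemma gi_gi a : inG G a -> gi (gi a) = a.
Proof. by move=> Ga; apply/esym/gi_unique; rewrite ?gmVl //; exact: gi_inG. Qed.

Lemma gi_gm a b : inG G a -> inG G b -> gi (gm a b) = gm (gi b) (gi a).
Proof.
move=> Ga Gb; have Gi := gi_inG Ga; have Gj := gi_inG Gb; apply/esym.
apply: gi_unique; try exact: gm_inG.
by rewrite -gmA ?(gmA Gb) ?gmVr ?gm1l ?gmVr //; apply: gm_inG.
Qed.

(** [subst_inv] describes the identity as an idempotent of the group; this recovers it. *)
Lemma idem_ge e : inG G e -> mulG G e e e -> e = ge.
Proof.
move=> Ge /(mulGE _ Ge Ge) E; have Gi := gi_inG Ge.
by rewrite -[LHS]gm1l // -{1}(gmVl Ge) -gmA // -E gmVl.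
Qed.

(* The condition [Y (a . b)], in a form that is definable for all tuples [a]
   and [b]; outside of [G] it is junk. *)
Definition mulX Y a b := exists c, mulG G a b c /\ Y c.

Lemma mulXE Y a b : inG G a -> inG G b -> (mulX Y a b <-> Y (gm a b)).
Proof.
move=> Ga Gb; split=> [[c [/(mulGE _ Ga Gb)->]]//|H].
by exists (gm a b); split=> //; apply/mulGE.
Qed.

Definition invX Y a := exists z e,
  [/\ inG G z, inG G e, mulG G e e e, mulG G a z e & Y z].

Lemma invXE Y a : inG G a -> (invX Y a <-> Y (gi a)).
Proof.
move=> Ga; split=> [[z [e [Gz Ge /(idem_ge Ge)-> /(mulGE _ Ga Gz)/esym]]]|H].
  by move=> /(gi_unique Ga Gz)->.
exists (gi a), ge; split=> //; first exact: gi_inG.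
- exact: ge_inG.
- by apply: (iffRL (mulGE _ ge_inG ge_inG)); rewrite gm1l //; exact: ge_inG.
- by apply: (iffRL (mulGE _ Ga (gi_inG Ga))); rewrite gmVr.
Qed.

Lemma Def_mulG A : Def A (fun v : ('I_k + 'I_k) + 'I_k -> U =>
  mulG G (v \o inl \o inl) (v \o inl \o inr) (v \o inr)).
Proof.
apply: Def_ext (Def_sat A (gmul G)) => v.
have {1}-> : v = join (join (v \o inl \o inl) (v \o inl \o inr)) (v \o inr).
  by apply: funext; case=> [[]|].
by [].
Qed.

Lemma Def_mulX A (V W : Type) (X : ('I_k + V -> U) -> Prop)
    (alpha beta : 'I_k -> W) (gamma : V -> W) :
  Def A X -> Def A (fun w : W -> U =>
    mulX (fun c => X (join c (w \o gamma))) (w \o alpha) (w \o beta)).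
Proof.
move=> DX; pose h : ('I_k + 'I_k) + 'I_k -> W + 'I_k :=
  join (join (inl \o alpha) (inl \o beta)) inr.
have D1 := Def_pre h (Def_mulG A).
have D2 := Def_pre (join inr (inl \o gamma) : 'I_k + V -> W + 'I_k) DX.
apply: Def_ext (Def_ex (Def_and D1 D2)) => w.
by split=> -[c] [H1 H2]; exists c; split=> //; move: H2; rewrite comp_join.
Qed.

Lemma Def_invX A (V W : Type) (X : ('I_k + V -> U) -> Prop)
    (alpha : 'I_k -> W) (gamma : V -> W) :
  Def A X -> Def A (fun w : W -> U =>
    invX (fun c => X (join c (w \o gamma))) (w \o alpha)).
Proof.
move=> DX; pose W2 := ((W + 'I_k) + 'I_k)%type.
pose z : 'I_k -> W2 := inl \o inr; pose e : 'I_k -> W2 := inr.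
have D1 := Def_pre z (Def_sat A (gdom G)).
have D2 := Def_pre e (Def_sat A (gdom G)).
have D3 := Def_pre (join (join e e) e) (Def_mulG A).
have D4 := Def_pre (join (join (inl \o inl \o alpha) z) e) (Def_mulG A).
have D5 := Def_pre (join z (inl \o inl \o gamma)) DX.
have D := Def_ex (Def_ex (Def_and D1 (Def_and D2 (Def_and D3 (Def_and D4 D5))))).
apply: Def_ext D => w; split=> -[a [b]].
  move=> [H1 [H2 [H3 [H4 H5]]]]; exists a, b; split=> //.
  by move: H5; rewrite comp_join.
move=> [H1 H2 H3 H4 H5]; exists a, b; do 4 split=> //.
by move: H5; rewrite comp_join.
Qed.

Lemma subst_rmulE phi b a :
  holds (subst_rmul G phi b) a <-> mulX (holds phi) a b.
Proof.
rewrite /holds /subst_rmul sat_Fexn; split=> -[c /= [H1 H2]]; exists c.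
  move: H1 H2; rewrite !sat_fren => H1 H2.
  split; [congr (sat _ _): H1|congr (sat _ _): H2].
    by apply: funext; case=> [[]|].
  by apply: funext; case.
rewrite /= !sat_fren; split; [congr (sat _ _): H1|congr (sat _ _): H2].
  by apply: funext; case=> [[]|].
by apply: funext; case.
Qed.

Lemma subst_invE phi a : holds (subst_inv G phi) a <-> invX (holds phi) a.
Proof.
rewrite /holds /subst_inv sat_Fexn; split=> [[z]|[z [e [H1 H2 H3 H4 H5]]]].
  move=> /sat_Fexn[e /= [[H1 H2] [[H3 H4] H5]]]; exists z, e.
  move: H1 H2 H3 H4 H5; rewrite !sat_fren => H1 H2 H3 H4 H5; split=> //.
  - by congr (sat _ _): H3; apply: funext; case=> [[]|].
  - by congr (sat _ _): H4; apply: funext; case=> [[]|].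
  - by congr (sat _ _): H5; apply: funext; case.
exists z; apply/sat_Fexn; exists e; rewrite /= !sat_fren; split; split=> //.
  by split; [congr (sat _ _): H3|congr (sat _ _): H4]; apply: funext; case=> [[]|].
by congr (sat _ _): H5; apply: funext; case.
Qed.

Section OnG.
Variable p : set (formula L ('I_k + U)).
Hypothesis Sp : S_G G p.

Lemma S_G_most : most p (inG G).
Proof.
by exists (fren inl (gdom G)); split; [exact: Sp.2|move=> a; rewrite /holds sat_fren].
Qed.

Lemma most_onG X Y : (forall a, inG G a -> (X a <-> Y a)) ->
  (most p X <-> most p Y).
Proof.
move=> XY; split=> H; have := most_and Sp.1 S_G_most H;
  by apply: most_mono => a [/XY E /E].
Qed.

Lemma most_mulX Y b : inG G b ->
  (most p (fun a => mulX Y a b) <-> most p (fun a => Y (gm a b))).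
Proof. by move=> Gb; apply: most_onG => a Ga; exact: mulXE. Qed.

Lemma most_invX Y : most p (invX Y) <-> most p (fun a => Y (gi a)).
Proof. by apply: most_onG => a Ga; exact: invXE. Qed.

Lemma rz_inG A b : rz p A b -> inG G b.
Proof. by move=> rb; apply: rb S_G_most; exact: Def_sat. Qed.
End OnG.

Lemma S_G_of p : complete_type p -> most p (inG G) -> S_G G p.
Proof.
move=> cp H; split=> //; apply/mostE => //.
by apply: most_mono H => a; rewrite /holds sat_fren.
Qed.

End GroupLaws.

(** * The semigroup of invariant types *)

Section Newelski.
Variables (kappa : Type) (L : language) (U : structure L) (M : set U).
Variables (k : nat) (G : definable_group U k).
Hypothesis smN : small kappa [set: nat].
Hypothesis satU : saturated (fun A : set U => small kappa A).
Hypothesis smM : small kappa M.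
Hypothesis HM : elem_substructure M.
Implicit Types (p q r : set (formula L ('I_k + U))) (X Y : ('I_k -> U) -> Prop).

Local Notation "p ** q" := (newelski G M p q) (at level 40).
Local Notation gm := (gm G).
Local Notation gi := (gi G).

Lemma rz_par q (V : finType) (d : V -> U) : complete_type q ->
  exists b, rz q (M `|` range d) b.
Proof. by move=> cq; apply: (rz_ex cq satU); apply: small_setU. Qed.

Lemma rz_model q : complete_type q -> exists b, rz q M b.
Proof. by move=> cq; apply: (rz_ex cq satU). Qed.

Lemma Def_params X : Def setT X ->
  exists (V : finType) (d : V -> U), Def (M `|` range d) X.
Proof.
move=> [P [psi [d [_ HX]]]]; exists P, d, P, psi, d.
by split=> // i; right; exists i.
Qed.

Lemma Def_parU V (W : finType) (X : (V + W -> U) -> Prop) (d : W -> U) :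
  Def M X -> Def (M `|` range d) (fun v => X (join v d)).
Proof.
move=> DX; apply: Def_par => [i|]; first by right; exists i.
by apply: Def_sub DX => x; left.
Qed.

(** Invariance of [q] makes the truth of [X] at a generic [b] over [d] a property of the type of [d]
    over [M]. *)
Lemma rz_eqv q (V : finType) (d d' : V -> U) b b' :
  complete_type q -> invariant M q -> eqv M d d' ->
  rz q (M `|` range d) b -> rz q (M `|` range d') b' ->
  eqv M (join b d) (join b' d').
Proof.
move=> cq iq dd' rb rb' X DX.
have dd'' := eqv_sym dd'.
rewrite (rzP cq rb (Def_parU d DX)) (rzP cq rb' (Def_parU d' DX)).
by split; [exact: (most_eqv cq iq DX dd')|exact: (most_eqv cq iq DX dd'')].
Qed.

Lemma most_gm_eqv p (V : finType) (d d' : V -> U) b b'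
    (R : ('I_k + V -> U) -> Prop) :
  S_inv G M p -> inG G b -> inG G b' -> Def M R ->
  eqv M (join b d) (join b' d') ->
  most p (fun a => R (join (gm a b) d)) -> most p (fun a => R (join (gm a b') d')).
Proof.
move=> [Sp ip] Gb Gb' DR bb'.
rewrite -2?(most_mulX Sp (fun c => R (join c _))) //.
have D := Def_mulX G (inl : 'I_k -> 'I_k + ('I_k + V)) (inr \o inl) (inr \o inr) DR.
by move=> H; apply: (most_eqv Sp.1 ip D bb').
Qed.

(** A third realization [c] of [q], over both [d] and [d'], mediates: it is compared with [b] over
    [d], then with [b'] over [d']. *)
Lemma newelski_indep p q X X' (V V' : finType) (d : V -> U) (d' : V' -> U) b b' :
  S_inv G M p -> S_inv G M q -> (forall a, X a <-> X' a) ->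
  Def (M `|` range d) X -> rz q (M `|` range d) b ->
  Def (M `|` range d') X' -> rz q (M `|` range d') b' ->
  most p (fun a => X (gm a b)) -> most p (fun a => X' (gm a b')).
Proof.
move=> Sp Sq XX' DX rb DX' rb' H.
have M0 := elem_substructure_nonempty HM.
have [Y [DY HY]] := Def_unpar M0 DX; have [Y' [DY' HY']] := Def_unpar M0 DX'.
have [c rc] := rz_par (join d d') Sq.1.1.
have rcd : rz q (M `|` range d) c.
  by apply: rz_sub rc => x [|[i _ <-]]; [left|right; exists (inl i)].
have rcd' : rz q (M `|` range d') c.
  by apply: rz_sub rc => x [|[i _ <-]]; [left|right; exists (inr i)].
have Gb := rz_inG Sq.1 rb; have Gb' := rz_inG Sq.1 rb'; have Gc := rz_inG Sq.1 rc.
apply: (most_mono (fun a => iffRL (HY' _))).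
have E' := rz_eqv Sq.1.1 Sq.2 (@eqv_refl _ _ M _ d') rcd' rb'.
apply: (most_gm_eqv Sp Gc Gb' DY' E').
apply: (most_mono (X := fun a => X (gm a c))) => [a|].
  by rewrite -HY' XX'.
apply: (most_mono (fun a => iffRL (HY _))).
have E := rz_eqv Sq.1.1 Sq.2 (@eqv_refl _ _ M _ d) rb rcd.
apply: (most_gm_eqv Sp Gb Gc DY E).
by apply: most_mono H => a; rewrite -HY.
Qed.

Lemma newelskiE p q phi X (V : finType) (d : V -> U) b :
  S_inv G M p -> S_inv G M q -> (forall a, holds phi a <-> X a) ->
  Def (M `|` range d) X -> rz q (M `|` range d) b ->
  ((p ** q) phi <-> most p (fun a => X (gm a b))).
Proof.
move=> Sp Sq HX DX rb; have Gb := rz_inG Sq.1 rb.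
have Dinst m (psi : formula L ('I_k + 'I_m)) (e : 'I_m -> U) :
    Def (M `|` range e) (holds (inst psi e)).
  apply/Def_over; exists (inst psi e); split=> //.
  by exists m, psi, e; split=> // i; right; exists i.
split=> [[m [psi [e [c [E /(realizesP Sq.1.1) rc]]]]]|H].
  rewrite (mostE Sp.1.1) (most_iff _ (subst_rmulE G _ _)).
  rewrite (most_mulX Sp.1 _ (rz_inG Sq.1 rc)).
  by apply: (newelski_indep Sp Sq _ (Dinst m psi e) rc DX rb) => a; rewrite -E HX.
have [m [psi [e [_ E]]]] := over_setT phi.
have [c rc] := rz_par e Sq.1.1.
exists m, psi, e, c; split=> //; first exact/(realizesP Sq.1.1).
rewrite (mostE Sp.1.1) (most_iff _ (subst_rmulE G _ _)).
rewrite (most_mulX Sp.1 _ (rz_inG Sq.1 rc)).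
by apply: (newelski_indep Sp Sq _ DX rb (Dinst m psi e) rc) H => a; rewrite -E HX.
Qed.

Lemma Def_gm A X b : inG G b -> Def A X ->
  exists Y, Def setT Y /\ forall a, inG G a -> (Y a <-> X (gm a b)).
Proof.
move=> Gb DX; exists (fun a => mulX G X a b).
split; last by move=> a Ga; exact: mulXE.
have DX' : Def setT (fun v : 'I_k + void -> U => X (v \o inl)).
  by apply: Def_pre; apply: Def_sub DX.
have := Def_mulX G (inl : 'I_k -> 'I_k + 'I_k) inr (of_void _) DX'.
by move=> /(Def_par (d := b)); apply.
Qed.

Lemma most_gm_not A p X b : S_G G p -> inG G b -> Def A X ->
  (most p (fun a => ~ X (gm a b)) <-> ~ most p (fun a => X (gm a b))).
Proof.
move=> Sp Gb DX; have [Y [DY HY]] := Def_gm Gb DX.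
rewrite -(most_onG Sp HY) -(most_not Sp.1 DY).
by apply: (most_onG Sp) => a Ga; rewrite HY.
Qed.

Lemma newelski_complete p q : S_inv G M p -> S_inv G M q -> complete_type (p ** q).
Proof.
move=> Sp Sq; apply: complete_type_directed.
- move=> phi psi H1 H2; exists (Fand phi psi); split=> //.
  have [V [d D1]] := Def_params (Def_holds phi).
  have [W [e D2]] := Def_params (Def_holds psi).
  have {}D1 : Def (M `|` range (join d e)) (holds phi).
    by apply: Def_sub D1 => x [|[i _ <-]]; [left|right; exists (inl i)].
  have {}D2 : Def (M `|` range (join d e)) (holds psi).
    by apply: Def_sub D2 => x [|[i _ <-]]; [left|right; exists (inr i)].
  have [b rb] := rz_par (join d e) Sq.1.1.
  move: H1 H2; rewrite (newelskiE Sp Sq _ D1 rb) // (newelskiE Sp Sq _ D2 rb) //.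
  rewrite (newelskiE Sp Sq _ (Def_and D1 D2) rb) //.
  by move=> H1 H2; exact: (most_and Sp.1.1 H1 H2).
- move=> phi; have [V [d D]] := Def_params (Def_holds phi).
  have [b rb] := rz_par d Sq.1.1.
  rewrite (newelskiE Sp Sq _ D rb) // => /(most_ex Sp.1.1)[a Ha].
  by exists (gm a b).
- move=> phi; have [V [d D]] := Def_params (Def_holds phi).
  have [b rb] := rz_par d Sq.1.1.
  rewrite (newelskiE Sp Sq _ D rb) // (newelskiE Sp Sq _ (Def_not D) rb) //.
  rewrite (most_gm_not Sp.1 (rz_inG Sq.1 rb) D).
  exact: EM.
Qed.

Lemma most_newelski p q X (V : finType) (d : V -> U) b :
  S_inv G M p -> S_inv G M q ->
  Def (M `|` range d) X -> rz q (M `|` range d) b ->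
  (most (p ** q) X <-> most p (fun a => X (gm a b))).
Proof.
move=> Sp Sq DX rb; have /Def_over[phi [_ HX]] := DX.
rewrite (most_iff _ HX) -(mostE (newelski_complete Sp Sq)).
by apply: newelskiE DX rb => // a; rewrite HX.
Qed.

Lemma most_newelski_model p q X b : S_inv G M p -> S_inv G M q ->
  Def M X -> rz q M b -> (most (p ** q) X <-> most p (fun a => X (gm a b))).
Proof.
move=> Sp Sq; rewrite -{1 2}[M]setU0 (_ : set0 = range (of_void U)).
  exact: most_newelski.
by apply/seteqP; split=> // x [[]].
Qed.

Lemma newelski_S_G p q : S_inv G M p -> S_inv G M q -> S_G G (p ** q).
Proof.
move=> Sp Sq; apply: S_G_of; first exact: newelski_complete.
have [b rb] := rz_model Sq.1.1; have Gb := rz_inG Sq.1 rb.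
rewrite (most_newelski_model Sp Sq _ rb); last exact: Def_sat.
by apply: most_mono (S_G_most Sp.1) => a Ga; apply: gm_inG.
Qed.

Lemma newelski_S_inv p q : S_inv G M p -> S_inv G M q -> S_inv G M (p ** q).
Proof.
move=> Sp Sq; split; first exact: newelski_S_G.
move=> n phi d d' /equiv_overP dd'.
have [b rb] := rz_par d Sq.1.1; have [b' rb'] := rz_par d' Sq.1.1.
have D := Def_sat M phi.
have H (e : 'I_n -> U) (a : 'I_k -> U) :
  holds (inst phi e) a <-> sat phi (join a e) by rewrite holds_inst.
rewrite (newelskiE Sp Sq (H d) (Def_parU d D) rb).
rewrite (newelskiE Sp Sq (H d') (Def_parU d' D) rb').
have dd'' := eqv_sym dd'.
have [Gb Gb'] := (rz_inG Sq.1 rb, rz_inG Sq.1 rb').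
have E := rz_eqv Sq.1.1 Sq.2 dd' rb rb'.
split; first exact: most_gm_eqv Sp Gb Gb' D E.
exact: most_gm_eqv Sp Gb' Gb D (eqv_sym E).
Qed.

(** If [c] realizes [r] over Md and [b] realizes [q] over Mdc, then b.c realizes q * r over Md; both
    sides then test phi at a.b.c for generic [a]. *)
Lemma newelskiA p q r : S_inv G M p -> S_inv G M q -> S_inv G M r ->
  p ** (q ** r) = (p ** q) ** r.
Proof.
move=> Sp Sq Sr; have Sqr := newelski_S_inv Sq Sr; have Spq := newelski_S_inv Sp Sq.
apply: complete_type_eq; [exact: newelski_complete..|].
move=> phi; have [V [d D]] := Def_params (Def_holds phi).
have [c rc] := rz_par d Sr.1.1; have [b rb] := rz_par (join d c) Sq.1.1.
have [Gc Gb] := (rz_inG Sr.1 rc, rz_inG Sq.1 rb).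
have Mdc : M `|` range d `<=` M `|` range (join d c).
  by move=> x [|[i _ <-]]; [left|right; exists (inl i)].
have Dc X : Def (M `|` range d) X ->
    Def (M `|` range (join d c)) (fun a => mulX G X a c).
  move=> DX; have := Def_pre (inl : 'I_k -> 'I_k + void) (Def_sub Mdc DX).
  move=> /(Def_mulX G (inl : 'I_k -> 'I_k + 'I_k) inr (of_void _)).
  move=> /(Def_par (d := c)); apply => i.
  by right; exists (inr i).
have rbc : rz (q ** r) (M `|` range d) (gm b c).
  move=> X DX; rewrite (most_newelski Sq Sr DX rc) -(most_mulX Sq.1) // => H.
  by apply/mulXE => //; apply: (rb _ (Dc _ DX)).
rewrite (newelskiE Sp Sqr _ D rbc) // (newelskiE Spq Sr _ D rc) //.
rewrite -(most_mulX Spq.1) // (most_newelski Sp Sq (Dc _ D) rb).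
apply: iffLR; apply: most_onG => // [|a Ga]; first exact: Sp.1.
have Gab := gm_inG Ga Gb.
by rewrite mulXE // gmA.
Qed.

Lemma S_fs_S_inv p : S_fs G M p -> S_inv G M p.
Proof. by move=> [Sp fp]; split=> //; apply: fin_sat_invariant => //; exact: Sp.1. Qed.

(** Finite satisfiability of [p] moves the left factor to some [a] in [M]. Then phi(a.y) has its
    parameters in Md, so that of [q] moves the right factor, and the product of the two points stays
    in [M] by elementarity. *)
Lemma newelski_S_fs p q : S_fs G M p -> S_fs G M q -> S_fs G M (p ** q).
Proof.
move=> Sp Sq; have [Sp' Sq'] := (S_fs_S_inv Sp, S_fs_S_inv Sq).
have SG := newelski_S_G Sp' Sq'; split=> //.
have cpq := SG.1; apply: fin_sat_in_directed.
- by exists (fren inl (gdom G)); exact: SG.2.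
- move=> phi psi H1 H2; exists (Fand phi psi); split=> //.
  exact: complete_and.
move=> phi; have [V [d D]] := Def_params (Def_holds phi).
have [b rb] := rz_par d Sq'.1.1; have Gb := rz_inG Sq.1 rb.
rewrite (newelskiE Sp' Sq' _ D rb) // => H.
have := most_and Sp.1.1 (S_G_most Sp.1) H.
move=> /(fin_sat_ex Sp.1.1 Sp.2)[a [Ma [Ga Ha]]].
have DX : Def (M `|` range d) (fun y => mulX G (holds phi) a y).
  have := Def_pre (inl : 'I_k -> 'I_k + void) D.
  move=> /(Def_mulX G (inr : 'I_k -> 'I_k + 'I_k) inl (of_void _)).
  by move=> /(Def_par (d := a)); apply => i; left.
have : most q (fun y => mulX G (holds phi) a y).
  by rewrite -(rzP Sq.1.1 rb DX); apply/mulXE.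
move=> /(most_and Sq.1.1 (S_G_most Sq.1))/(fin_sat_ex Sq.1.1 Sq.2).
move=> [c [Mc [Gc /(mulXE _ Ga Gc) Hc]]].
have [||e [Me]] := @Tarski_Vaught _ _ _ HM _ (fun e => mulG G a c e).
- have := Def_mulG G M.
  move=> /(Def_pre (join (join (inr \o inl) (inr \o inr)) inl
     : ('I_k + 'I_k) + 'I_k -> 'I_k + ('I_k + 'I_k))).
  by move=> /(Def_par (d := join a c)); apply => -[].
- by exists (gm a c); apply/mulGE.
by move=> /(mulGE _ Ga Gc) E; exists (gm a c); rewrite -{1}E.
Qed.

End Newelski.

(** * Ellis subgroups of abstract semigroups *)

Section AbstractEllis.
Variables (X : Type) (op : X -> X -> X) (S H : set X) (u : X).
Hypothesis HS : H `<=` S.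
Hypothesis Hu : H u.
Hypothesis mul1x : forall x, H x -> op u x = x.
Hypothesis mulx1 : forall x, H x -> op x u = x.
Hypothesis mulVx : forall x, H x -> exists2 y, H y & op y x = u.

(** Minimality of S * u: if [z] is in a left ideal [J] inside it, then u * z is in [H] because [H]
    is a right ideal, and a left inverse of u * z brings [u] into [J]. *)
Lemma ellis_right_ideal :
  (forall x y, S x -> S y -> S (op x y)) ->
  (forall x y z, S x -> S y -> S z -> op x (op y z) = op (op x y) z) ->
  (forall x y, H x -> S y -> H (op x y)) ->
  ellis_subgroup op S H.
Proof.
move=> clS opA HSH; have Su := HS Hu.
exists [set op s u | s in S], u; split.
- split.
    split=> [_ [s Ss <-]||s _ Ss [s' Ss' <-]]; first exact: clS.
      by exists (op u u), u.
    by exists (op s s'); [exact: clS|rewrite opA].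
  move=> J [JS [z Jz] JI] sub; apply/seteqP; split=> // _ [s Ss <-].
  have Sz := JS _ Jz; have Huz := HSH _ _ Hu Sz.
  have [y Hy yz] := mulVx Huz; apply: (JI) => //.
  by rewrite -yz; apply: (JI); [exact: HS|apply: (JI)].
- by exists u => //; exact: mul1x.
- exact: mul1x.
- apply/seteqP; split=> [x Hx|_ [_ [s Ss <-] <-]].
    exists (op x u); last by rewrite mulx1 // mul1x.
    by exists x => //; exact: HS.
  by apply: HSH => //; exact: clS.
Qed.

(** Here [H] is itself the minimal left ideal, since a left ideal contained in a group is the whole
    group. *)
Lemma ellis_left_ideal :
  (forall x y, S x -> H y -> H (op x y)) -> ellis_subgroup op S H.
Proof.
move=> SHH; exists H, u; split=> //.
- split; first by split=> //; exists u.
  move=> J [JS [z Jz] JI] sub; apply/seteqP; split=> // x Hx.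
  have [y Hy yz] := mulVx (sub _ Jz).
  rewrite -(mulx1 Hx) -yz; apply: (JI); first exact: HS.
  by apply: (JI) => //; exact: HS.
- exact: mul1x.
- apply/seteqP; split=> [x Hx|_ [x Hx <-]]; first by exists x => //; exact: mul1x.
  by rewrite mul1x.
Qed.

End AbstractEllis.

(** * Right dfg types *)

Section Dfg.
Variables (kappa : Type) (L : language) (U : structure L) (M : set U).
Variables (k : nat) (G : definable_group U k).
Hypothesis smN : small kappa [set: nat].
Hypothesis satU : saturated (fun A : set U => small kappa A).
Hypothesis smM : small kappa M.
Hypothesis HM : elem_substructure M.
Implicit Types (p q r : set (formula L ('I_k + U))) (X Y : ('I_k -> U) -> Prop).

Local Notation "p ** q" := (newelski G M p q) (at level 40).
Local Notation "p .* c" := (rtranslate G p c) (at level 40).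
Local Notation gm := (gm G).
Local Notation gi := (gi G).
Local Notation ge := (ge G).

(** Serves both translation and inversion: [q] is the image of [p] under [h]. Preimages under [h]
    need to be definable only on [G], where [p] is concentrated. *)
Lemma complete_push p q (h : ('I_k -> U) -> 'I_k -> U) :
  S_G G p ->
  (forall X, Def setT X ->
     exists Y, Def setT Y /\ forall a, inG G a -> (Y a <-> X (h a))) ->
  (forall phi, q phi <-> most p (fun a => holds phi (h a))) ->
  complete_type q.
Proof.
move=> Sp Hh Hq; apply: complete_type_directed => [phi psi|phi|phi].
- move=> /Hq H1 /Hq H2; exists (Fand phi psi); split=> //.
  exact/Hq/(most_and Sp.1 H1 H2).
- by move=> /Hq/(most_ex Sp.1)[a Ha]; exists (h a).
- rewrite !Hq; have [Y [DY HY]] := Hh _ (Def_holds phi).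
  rewrite -(most_onG Sp HY).
  have [H|/(most_not Sp.1 DY) H] := pselect (most p Y); [by left|right].
  by apply: (iffLR (most_onG Sp _)) H => a Ga; rewrite HY.
Qed.

Lemma most_push p q (h : ('I_k -> U) -> 'I_k -> U) X :
  (forall phi, q phi <-> most p (fun a => holds phi (h a))) ->
  Def setT X -> complete_type q -> (most q X <-> most p (fun a => X (h a))).
Proof.
move=> Hq /Def_over[phi [_ HX]] cq.
by rewrite (most_iff _ HX) -(mostE cq) Hq; apply: most_iff => a; rewrite HX.
Qed.

Section Translate.
Variables (p : set (formula L ('I_k + U))) (c : 'I_k -> U).
Hypotheses (Sp : S_G G p) (Gc : inG G c).

Lemma rtranslateE phi : (p .* c) phi <-> most p (fun a => holds phi (gm a c)).
Proof.
rewrite /rtranslate /= (mostE Sp.1) (most_iff _ (subst_rmulE G _ _)).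
exact: most_mulX.
Qed.

Lemma rtranslate_complete : complete_type (p .* c).
Proof.
apply: (complete_push Sp) rtranslateE => X DX.
exact: Def_gm DX.
Qed.

Lemma most_rtranslate X : Def setT X ->
  (most (p .* c) X <-> most p (fun a => X (gm a c))).
Proof.
by move=> DX; apply: (most_push rtranslateE DX); exact: rtranslate_complete.
Qed.

Lemma rtranslate_S_G : S_G G (p .* c).
Proof.
apply: S_G_of; first exact: rtranslate_complete.
rewrite most_rtranslate; last exact: Def_sat.
by apply: most_mono (S_G_most Sp) => a Ga; apply: gm_inG.
Qed.

End Translate.

Lemma rtranslateM p b c : S_G G p -> inG G b -> inG G c ->
  (p .* b) .* c = p .* (gm b c).
Proof.
move=> Sp Gb Gc; have Spb := rtranslate_S_G Sp Gb; have Gbc := gm_inG Gb Gc.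
apply/predeqP => phi; rewrite !rtranslateE //.
have [Y [DY HY]] := Def_gm Gc (Def_holds phi).
rewrite -(most_onG Spb HY) (most_rtranslate Sp Gb DY).
by apply: (most_onG Sp) => a Ga; rewrite HY ?gmA //; apply: gm_inG.
Qed.

Lemma rtranslate1 p : S_G G p -> p .* ge = p.
Proof.
move=> Sp; apply/predeqP => phi; rewrite rtranslateE //; last exact: ge_inG.
by rewrite [X in _ <-> X](mostE Sp.1); apply: (most_onG Sp) => a Ga; rewrite gm1r.
Qed.

Definition rdfg p := S_G G p /\ right_dfg G M p.

Lemma rdfg_S_inv p : rdfg p -> S_inv G M p.
Proof. by move=> [Sp [dp _]]; split=> //; apply: definable_invariant. Qed.

Lemma rdfg_rtranslate p c : rdfg p -> inG G c -> rdfg (p .* c).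
Proof.
move=> [Sp [dp tp]] Gc; split; first exact: rtranslate_S_G.
split=> [|d Gd]; first exact: tp.
by rewrite rtranslateM //; apply: tp; apply: gm_inG.
Qed.

(* The translates by [c] and [c'] are defined by the fibres over [c] and [c']
   of one M-definable relation, and the fibre over [c'] is itself M-definable;
   so the fact that a given M-formula defines it passes from [c'] to [c]. *)
Lemma rtranslate_eqv p c c' : rdfg p -> inG G c -> inG G c' -> eqv M c c' ->
  p .* c = p .* c'.
Proof.
move=> [Sp [dp tp]] Gc Gc' cc'; apply: complete_type_eq;
  [exact: rtranslate_complete..|].
move=> phi; have [m [psi [d [_ ->]]]] := over_setT phi.
have [chi [Mchi Hchi]] := tp _ Gc' _ psi.
have Dchi : Def M (holds chi) by apply/Def_over; exists chi.
pose Theta (v : 'I_k + 'I_m -> U) := most p (fun a =>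
  mulX G (fun x => sat psi (join x (v \o inr))) a (v \o inl)).
have ThetaE y e : inG G y -> (Theta (join y e) <-> (p .* y) (inst psi e)).
  move=> Gy; rewrite rtranslateE // -(most_mulX Sp _ Gy).
  by apply: (most_onG Sp) => a Ga; rewrite !mulXE // holds_inst.
have DTheta : Def M Theta.
  have := Def_mulX G (inl : 'I_k -> 'I_k + ('I_k + 'I_m)) (inr \o inl)
    (inr \o inr) (Def_sat M psi).
  by move=> /(Def_most Sp.1 dp).
have DQ := Def_all (Def_iff DTheta (Def_pre (inr : 'I_m -> 'I_k + 'I_m) Dchi)).
have := cc' _ DQ => /= -[_ H].
rewrite -ThetaE // => Hd; apply/Hchi.
by apply/(H _ d) => // e; rewrite ThetaE // -Hchi.
Qed.

Lemma newelski_rdfg p q c : rdfg p -> S_inv G M q -> rz q M c ->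
  p ** q = p .* c.
Proof.
move=> dp Sq rc; have Sp := rdfg_S_inv dp.
apply: complete_type_eq; first exact: (newelski_complete smN satU smM HM).
  by apply: rtranslate_complete; [exact: Sp.1|exact: (rz_inG Sq.1 rc)].
move=> phi; have [V [d D]] := Def_params M (Def_holds phi).
have [b rb] := rz_par smN satU smM d Sq.1.1.
have [Gb Gc] := (rz_inG Sq.1 rb, rz_inG Sq.1 rc).
rewrite (newelskiE smN satU smM HM Sp Sq _ D rb) // -rtranslateE //; last exact: Sp.1.
rewrite (rtranslate_eqv dp Gb Gc) // => X DX.
by rewrite (rzP Sq.1.1 rc DX) (rzP Sq.1.1 rb) //; apply: Def_sub DX => x; left.
Qed.

Variable t : set (formula L ('I_k + U)).
Hypothesis dt : rdfg t.
Variable a0 : 'I_k -> U.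
Hypothesis ra0 : rz t M a0.

Definition orbit := [set t .* g | g in inG G].

Let Ga0 : inG G a0 := rz_inG dt.1 ra0.

Lemma orbit_rdfg p : orbit p -> rdfg p.
Proof. by move=> [g Gg <-]; exact: rdfg_rtranslate. Qed.

Lemma orbit_S_inv : orbit `<=` S_inv G M.
Proof. by move=> p /orbit_rdfg; exact: rdfg_S_inv. Qed.

Lemma orbit_rtranslate p c : orbit p -> inG G c -> orbit (p .* c).
Proof.
move=> [g Gg <-] Gc; exists (gm g c); first exact: gm_inG.
by rewrite rtranslateM //; exact: dt.1.
Qed.

(** If [a] realizes [t] over Mc, then a.c realizes t.c over [M], so the product is (t.b).a.c. Since
    t.b is again right dfg, only the type of [a] over [M] matters and [a0] may replace it. *)
Lemma newelski_orbit b c : inG G b -> inG G c ->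
  (t .* b) ** (t .* c) = t .* (gm b (gm a0 c)).
Proof.
move=> Gb Gc; have St := dt.1; have dtb := rdfg_rtranslate dt Gb.
have dtc := rdfg_rtranslate dt Gc.
have [a ra] := rz_par smN satU smM c St.1; have Ga := rz_inG St ra.
have rac : rz (t .* c) M (gm a c).
  move=> X DX; rewrite most_rtranslate //; last exact: Def_sub DX.
  rewrite -(most_mulX St) // => H; apply/mulXE => //; apply: ra H.
  have := Def_pre (inl : 'I_k -> 'I_k + void) DX.
  move=> /(Def_mulX G (inl : 'I_k -> 'I_k + 'I_k) inr (of_void _)).
  by move=> /(Def_parU c).
rewrite (newelski_rdfg dtb (rdfg_S_inv dtc) rac).
have Stb := dtb.1; have Ga0c := gm_inG Ga0 Gc; have Gab0 := gm_inG Gb Ga0.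
rewrite -rtranslateM // (rtranslate_eqv dtb Ga Ga0) ?rtranslateM ?gmA // => X DX.
by rewrite (rzP St.1 ra0 DX) (rzP St.1 ra) //; apply: Def_sub DX => x; left.
Qed.

Lemma newelski_orbit_image :
  [set t ** q | q in S_inv G M] = orbit.
Proof.
apply/seteqP; split=> [_ [q Sq <-]|_ [g Gg <-]].
  have [c rc] := rz_model satU smM Sq.1.1; exists c; first exact: (rz_inG Sq.1 rc).
  by rewrite (newelski_rdfg dt Sq rc).
have Gi := gi_inG Ga0; have Gh := gm_inG Gi Gg.
(* With [t] read as t.e, the product law asks for an element x with a0.x = g. *)
exists (t .* gm (gi a0) g).
  by apply: rdfg_S_inv; apply: rdfg_rtranslate.
rewrite -{1}(rtranslate1 dt.1) newelski_orbit //; last exact: ge_inG.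
by rewrite gm1l ?gmA ?gmVr ?gm1l //; apply: gm_inG => //; apply: gm_inG.
Qed.

Lemma orbit_newelski p q : orbit p -> S_inv G M q -> orbit (p ** q).
Proof.
move=> Op Sq; have [c rc] := rz_model satU smM Sq.1.1.
rewrite (newelski_rdfg (orbit_rdfg Op) Sq rc).
by apply: orbit_rtranslate => //; exact: (rz_inG Sq.1 rc).
Qed.

Lemma orbit_unit : orbit (t .* gi a0).
Proof. by exists (gi a0) => //; exact: gi_inG. Qed.

Lemma orbit_mul1p p : orbit p -> (t .* gi a0) ** p = p.
Proof.
move=> [g Gg <-]; have Gi := gi_inG Ga0.
by rewrite newelski_orbit // gmA // gmVl // gm1l.
Qed.

Lemma orbit_mulp1 p : orbit p -> p ** (t .* gi a0) = p.
Proof.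
move=> [g Gg <-]; have Gi := gi_inG Ga0.
by rewrite newelski_orbit // gmVr // gm1r.
Qed.

Lemma orbit_inv p : orbit p -> exists q,
  [/\ orbit q, q ** p = t .* gi a0 & p ** q = t .* gi a0].
Proof.
move=> [g Gg <-]; have [Gi Gj] := (gi_inG Ga0, gi_inG Gg).
have Gij := gm_inG Gi Gj; have Gh := gm_inG Gij Gi; have Gag := gm_inG Ga0 Gg.
(* This [h] solves both h.a0.g = a0^-1 and g.a0.h = a0^-1. *)
pose h := gm (gm (gi a0) (gi g)) (gi a0).
exists (t .* h); split; rewrite /h; first by exists h.
  rewrite newelski_orbit // -(gmA Gij) // (gmA Gi) // gmVl // gm1l //.
  by rewrite -gmA // gmVl // gm1r.
rewrite newelski_orbit //; congr (t .* _).
rewrite (gmA Ga0 Gij Gi) (gmA Ga0 Gi Gj) gmVr // gm1l //.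
by rewrite gmA // gmVr // gm1l.
Qed.

Lemma orbit_ellis : ellis_subgroup (newelski G M) (S_inv G M) orbit.
Proof.
apply: (@ellis_right_ideal _ _ _ _ (t .* gi a0)).
- exact: orbit_S_inv.
- exact: orbit_unit.
- exact: orbit_mul1p.
- exact: orbit_mulp1.
- by move=> p /orbit_inv[q [Oq qp _]]; exists q.
- exact: (newelski_S_inv smN satU smM HM).
- exact: (newelskiA smN satU smM HM).
- exact: orbit_newelski.
Qed.

End Dfg.

(** * Coheirs of definable types in NIP theories *)

Lemma Def_forall (L : language) (U : structure L) (A : set U) (V : Type)
    (I : finType) (X : I -> (V -> U) -> Prop) :
  (forall i, Def A (X i)) -> Def A (fun v => forall i, X i v).
Proof.
move=> DX.
suff H (s : seq I) : Def A (fun v => forall i, i \in s -> X i v).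
  by apply: Def_ext (H (enum I)) => v; split=> [H' i|//]; apply: H'; rewrite mem_enum.
elim: s => [|i s IH].
  have [u0] := carrier_inhabited U.
  pose tau : sentence L := Fex (Feq (Tvar None) (Tvar None)).
  apply: Def_ext (Def_sat A (fren (of_void V) tau)) => v.
  by split=> // _; exists u0.
apply: Def_ext (Def_and (DX i) IH) => v; split=> [[Xi Xs] l|H].
  by rewrite inE => /orP[/eqP->|/Xs].
split; first by apply: H; rewrite inE eqxx.
by move=> l ls; apply: H; rewrite inE ls orbT.
Qed.

Section Coheir.
Variables (kappa : Type) (L : language) (U : structure L) (M : set U) (k : nat).
Hypothesis smN : small kappa [set: nat].
Hypothesis satU : saturated (fun A : set U => small kappa A).
Hypothesis smM : small kappa M.
Hypothesis HM : elem_substructure M.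
Variable r : set (formula L ('I_k + U)).
Hypothesis cr : complete_type r.
Hypothesis dr : definable_over M r.

(* For [r] definable over [M] in a NIP theory, the definable [X] with
   [coheir X] form the unique coheir of the restriction of [r] to [M]. *)
Definition coheir (X : ('I_k -> U) -> Prop) := exists chi,
  [/\ Def M chi, most r chi & forall a, (forall i, M (a i)) -> chi a -> X a].

(** * Iterated generic quantifiers and patterns of truth values *)

Section Pattern.
Variable m : nat.
Implicit Types (v : 'I_m * 'I_k -> U) (Y : ('I_m * 'I_k -> U) -> Prop).

Definition upd v (j : nat) (x : 'I_k -> U) : 'I_m * 'I_k -> U :=
  fun z => if val z.1 == j then x z.2 else v z.

(* [iter_most m Y] says that [Y] holds of most m-tuples in the sense of the
   Morley product of [r], slot 0 being chosen first. *)
Fixpoint iter_most (c : nat) Y v : Prop :=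
  if c is c'.+1 then most r (fun x => iter_most c' Y (upd v (m - c) x)) else Y v.

Lemma upd_join v j x : upd v j x =
  join x v \o (fun z => if val z.1 == j then inl z.2 else inr z).
Proof. by apply: funext => z; rewrite /upd /=; case: ifP. Qed.

Lemma Def_iter_most c Y : Def M Y -> Def M (iter_most c Y).
Proof.
move=> DY; elim: c => [//|c IH] /=.
have := Def_pre (fun z : 'I_m * 'I_k =>
  if val z.1 == (m - c.+1)%N then inl z.2 else inr z : 'I_k + 'I_m * 'I_k) IH.
move=> /(Def_most cr dr); apply: Def_ext => v.
by apply: most_iff => x; rewrite upd_join.
Qed.

Lemma Def_iter_most_upd A c Y v j : Def M Y -> M `<=` A -> (forall z, A (v z)) ->
  Def A (fun x => iter_most c Y (upd v j x)).
Proof.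
move=> DY MA Av; have := Def_pre (fun z : 'I_m * 'I_k =>
  if val z.1 == j then inl z.2 else inr z : 'I_k + 'I_m * 'I_k)
  (Def_sub MA (Def_iter_most c DY)).
by move=> /(Def_par Av); apply: Def_ext => x; rewrite upd_join.
Qed.

Lemma iter_most_Morley Y (a : nat -> 'I_k -> U) (A : nat -> set U) u0 :
  Def M Y -> M u0 -> (forall n, M `<=` A n) ->
  (forall i n l, (i < n)%N -> A n (a i l)) -> (forall n, rz r (A n) (a n)) ->
  Y (fun z => a z.1 z.2) -> iter_most m Y (fun=> u0).
Proof.
move=> DY Mu0 MA Aa ra Ya.
(* Slots below [j] carry the sequence, the others the default [u0], which the remaining quantifiers
   overwrite. The induction starts from the innermost quantifier; the one for slot [j] is evaluated
   at [a j], generic over the earlier terms. *)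
pose v j (z : 'I_m * 'I_k) := if (z.1 < j)%N then a z.1 z.2 else u0.
have -> : (fun=> u0) = v 0 by [].
suff H c : (c <= m)%N -> iter_most c Y (v (m - c)%N).
  by rewrite -(subnn m); exact: H.
elim: c => [_|c IH cm] /=.
  by congr Y: Ya; apply: funext => z; rewrite /v subn0 ltn_ord.
set j := (m - c.+1)%N; have Ej : (m - c)%N = j.+1 by rewrite -subSn.
have D : Def (A j) (fun x => iter_most c Y (upd (v j) j x)).
  by apply: Def_iter_most_upd => // z; rewrite /v; case: ifP => [/Aa|_] //; exact: MA.
apply/(rzP cr (ra j) D).
congr (iter_most c Y _): (IH (ltnW cm)); apply: funext => z; rewrite /v /upd Ej ltnS.
by case: ltngtP => // ->.
Qed.

(** Slots are filled from the outermost quantifier inwards. As the points chosen lie in [M], what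
    remains to be satisfied is an M-definable condition of [r], to which [HX] applies with the next
    value of [beta]. *)
Lemma iter_most_pattern Y (X : ('I_k -> U) -> Prop) u0 (beta : nat -> bool) :
  (forall chi (b : bool), Def M chi -> most r chi ->
    exists a, [/\ forall i, M (a i), chi a & (X a <-> b)]) ->
  Def M Y -> M u0 -> iter_most m Y (fun=> u0) ->
  exists2 v, Y v & forall i : 'I_m, X (fun l => v (i, l)) <-> beta i.
Proof.
move=> HX DY Mu0 H0.
suff H l : (l <= m)%N -> exists v, [/\ forall z, M (v z), iter_most (m - l) Y v &
    forall i : 'I_m, (i < l)%N -> (X (fun l => v (i, l)) <-> beta i)].
  have [v [_]] := H m (leqnn m); rewrite subnn => Yv Hv.
  by exists v => // i; exact: Hv.
elim: l => [_|l IH lm]; first by exists (fun=> u0); split=> //; rewrite subn0.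
have [v [Mv]] := IH (ltnW lm).
have -> : (m - l)%N = (m - l.+1).+1 by rewrite -subSn.
rewrite /= (_ : (m - (m - l.+1).+1)%N = l); last first.
  by rewrite -subSn // subSS subKn // ltnW.
move=> Hm Hv.
have D := Def_iter_most_upd (m - l.+1) l DY (@subset_refl _ M) Mv.
have [x [Mx Hx Xx]] := HX _ (beta l) D Hm.
exists (upd v l x); split=> // [z|i]; first by rewrite /upd; case: ifP.
rewrite ltnS leq_eqVlt => /orP[/eqP E|il]; rewrite /upd /=.
  by rewrite E eqxx.
by rewrite (ltn_eqF il); exact: Hv.
Qed.
End Pattern.

Lemma Morley_sequence : exists (A : nat -> set U) (a : nat -> 'I_k -> U),
  [/\ forall n, M `<=` A n, forall i n l, (i < n)%N -> A n (a i l) &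
      forall n, rz r (A n) (a n)].
Proof.
(* Choosing for every set, with a dummy value off the small ones, keeps the recursion defining [A]
   free of smallness proofs. *)
have /choice[pick Hpick] A : exists b, small kappa A -> rz r A b.
  have [smA|nsmA] := pselect (small kappa A).
    by have [b rb] := rz_ex cr satU smA; exists b.
  by have [u0] := carrier_inhabited U; exists (fun=> u0).
pose A := fix A n := if n is m.+1 then A m `|` range (pick (A m)) else M.
exists A, (fun n => pick (A n)); split.
- by elim=> //= n IH x /IH; left.
- move=> i n l; elim: n => // n IH; rewrite ltnS leq_eqVlt => /orP[/eqP->|/IH].
    by right; exists l.
  by left.
- by move=> n; apply: Hpick; elim: n => //= n IH; apply: small_setU.
Qed.

Variable T : set (sentence L).
Hypothesis TU : model_of T U.
Hypothesis HNIP : NIP T.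

(* If [X] splits the filter, then any finite pattern of truth values of
   [X = theta(-, d)] is realized along tuples from [M] sharing any given
   M-formula with a Morley sequence of [r]; hence [theta] shatters a Morley
   sequence. *)
Lemma coheir_decides X : Def setT X -> coheir X \/ coheir (fun a => ~ X a).
Proof.
move=> /Def_over[_ [[n [theta [d [_ ->]]]] HX]].
apply: contrapT => /not_orP[H1 H2].
have pick chi (b : bool) : Def M chi -> most r chi ->
    exists a, [/\ forall i, M (a i), chi a & (X a <-> b)].
  move=> Dchi mchi; apply: contrapT => H; case: b H => H.
    apply: H2; exists chi; split=> // a Ma chia Xa.
    by apply: H; exists a.
  apply: H1; exists chi; split=> // a Ma chia; apply: contrapT => Xa.
  by apply: H; exists a.
have [u0 Mu0] := elem_substructure_nonempty HM.
have [A [a [MA Aa ra]]] := Morley_sequence.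
have pat m (beta : nat -> bool) : exists y : 'I_n -> U,
    forall i, (i < m)%N -> (sat theta (join (a i) y) <-> beta i).
  pose chi (v : 'I_m * 'I_k -> U) := exists y : 'I_n -> U, forall i : 'I_m,
    sat theta (join (fun l => v (i, l)) y) <-> beta i.
  have Dchi : Def M chi.
    pose R (i : 'I_m) (v : 'I_m * 'I_k + 'I_n -> U) :=
      sat theta (join (fun l => v (inl (i, l))) (v \o inr)) <-> beta i.
    apply: Def_ext (Def_ex (Def_forall (X := R) _)) => [v|i]; first by [].
    pose h : 'I_k + 'I_n -> 'I_m * 'I_k + 'I_n := join (fun l => inl (i, l)) inr.
    have D := Def_pre h (Def_sat M theta); rewrite /R.
    case: (beta i); [apply: Def_ext D|apply: Def_ext (Def_not D)] => v;
      rewrite comp_join /=.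
      by split=> [|[_]]; [|apply].
    by split=> [H|[H _] /H].
  have : chi (fun z => a z.1 z.2).
    (* If the Morley sequence failed [chi], some tuple on which [X] follows [beta] would fail it
       too, although [d] is a witness of [chi] there. *)
    apply: contrapT => nchi.
    have H := iter_most_Morley (Def_not Dchi) Mu0 MA Aa ra nchi.
    have [v nv Hv] := iter_most_pattern beta pick (Def_not Dchi) Mu0 H.
    by apply: nv; exists d => i; rewrite -Hv HX holds_inst.
  by move=> [y Hy]; exists y => i im; exact: (Hy (Ordinal im)).
(* The pattern true at [i] alone separates [a i] from every other term; this makes the range
   infinite. *)
have ainj : injective a.
  move=> i l E; apply: contrapT => il.
  have [y Hy] := pat (maxn i l).+1 (fun x => x == i).
  have := Hy i; have := Hy l; rewrite !ltnS leq_maxl leq_maxr -E eqxx.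
  move=> /(_ isT) [H3 _] /(_ isT) [_ /(_ isT)/H3/eqP li].
  exact/il/esym.
have infa : infinite_set (range a).
  rewrite (eq_finite_set (B := [set: nat])); first exact: infinite_nat.
  by apply: inj_card_eq => x y _ _; exact: ainj.
apply: (HNIP TU infa (phi := theta)) => B BA.
pose psi : formula L ('I_n + 'I_k) := fren (join inr inl) theta.
pose F i (b : bool) : formula L ('I_n + U) :=
  fren (join inl (inr \o a i)) (if b then psi else Fnot psi).
have FE i b y : holds (F i b) y <-> (sat theta (join (a i) y) <-> b).
  have E : holds (fren (join inl (inr \o a i)) psi) y <-> sat theta (join (a i) y).
    by rewrite /holds !sat_fren !comp_join.
  case: b => /=; first by rewrite E; split=> [|[_]]; [|apply].
  split=> [H|[H _] /E/H//]; by split=> // /E/H.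
(* Patterns on finite initial segments extend to any subset of the sequence by saturation over this
   countable set. *)
pose A' := range (fun z : nat * 'I_k => a z.1 z.2).
pose S := [set F i `[< B (a i) >] | i in [set: nat]].
have smA' : small kappa A'.
  apply: countable_small => //; apply: sub_countable (card_image_le _ _) _.
  exact: countableP.
have [||y Hy] := satU smA' (S := S).
- by move=> _ [i _ <-]; apply: over_fren => l; exists (i, l).
- move=> S0 finS0 S0S.
  pose P m phi := exists2 i, (i < m)%N & phi = F i `[< B (a i) >].
  have [||m Hm] := @finite_set_directed _ _ P 0%N S0 _ finS0.
  + move=> i l; exists (maxn i l) => phi [] [x xi ->]; exists x => //;
      by rewrite leq_max xi ?orbT.
  + by move=> phi /S0S[i _ <-]; exists i.+1, i.
  have [y Hy] := pat m (fun i => `[< B (a i) >]).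
  by exists y; split=> // phi /Hm[i im ->]; apply/FE; exact: Hy.
exists y => _ [i _ <-].
have /FE : holds (F i `[< B (a i) >]) y by apply: Hy; exists i.
by move=> E; split=> [/E/asboolP|/asboolP/E].
Qed.

End Coheir.

(** * Transfer to the pair extension *)

Section PairFormulas.
Variable L : language.

Fixpoint tlift (V : Type) (s : term L V) : term (lang_pred L) V :=
  match s with
  | Tvar v => Tvar v
  | Tapp f args => @Tapp (lang_pred L) V f (fun i => tlift (args i))
  end.

Fixpoint flift (V : Type) (phi : formula L V) : formula (lang_pred L) V :=
  match phi with
  | Feq s1 s2 => Feq (tlift s1) (tlift s2)
  | Frel r args => @Frel (lang_pred L) _ (Some r) (fun i => tlift (args i))
  | Fnot psi => Fnot (flift psi)
  | Fand psi1 psi2 => Fand (flift psi1) (flift psi2)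
  | Fex psi => Fex (flift psi)
  end.

Fixpoint all_pred (V : Type) (s : seq V) : formula (lang_pred L) V :=
  if s is x :: s' then
    Fand (@Frel (lang_pred L) V None (fun=> Tvar x)) (all_pred s')
  else Fex (Feq (Tvar None) (Tvar None)).

Variables (N : structure L) (P : set N).

Lemma teval_tlift (V : Type) (v : V -> N) (s : term L V) :
  @teval _ (pair_structure P) V v (tlift s) = teval v s.
Proof.
by elim: s => [//|f args IH] /=; congr fint; apply: funext => i; exact: IH.
Qed.

Lemma sat_flift (V : Type) (v : V -> N) (phi : formula L V) :
  @sat _ (pair_structure P) V (flift phi) v = sat phi v.
Proof.
elim: phi v => {V} /=.
- by move=> V s1 s2 v; rewrite !teval_tlift.
- by move=> V r args v; congr rint; apply: funext => i; exact: teval_tlift.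
- by move=> V psi IH v; rewrite IH.
- by move=> V psi1 IH1 psi2 IH2 v; rewrite IH1 IH2.
- by move=> V psi IH v; congr ex; apply: funext => c; exact: IH.
Qed.

Lemma sat_all_pred (V : eqType) (s : seq V) (v : V -> N) :
  @sat _ (pair_structure P) V (all_pred s) v <-> forall x, x \in s -> P (v x).
Proof.
elim: s => [|x s IH] /=.
  by have [u0] := carrier_inhabited N; split=> // _; exists u0.
rewrite IH; split=> [[Px Ps] y|H].
  by rewrite inE => /orP[/eqP->|/Ps].
split; first by apply: H; rewrite inE eqxx.
by move=> y ys; apply: H; rewrite inE ys orbT.
Qed.

Variables (V : Type) (m k : nat).
Variables (R1 : formula L ('I_m + V)) (R2 : formula L (('I_k + 'I_m) + V)).

Definition rel_forall_exists : formula (lang_pred L) V :=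
  Fnot (Fexn (Fand (Fand (fren inr (all_pred (enum 'I_m)))
                         (flift (fren (join inr inl) R1)))
    (Fnot (Fexn (Fand (fren inr (all_pred (enum 'I_k)))
       (flift (fren (join (join inr (inl \o inr)) (inl \o inl)) R2))))))).

Lemma sat_rel_forall_exists (v : V -> N) :
  @sat _ (pair_structure P) V rel_forall_exists v <->
  forall n : 'I_m -> N, (forall i, P (n i)) -> sat R1 (join n v) ->
    exists a : 'I_k -> N, (forall i, P (a i)) /\ sat R2 (join (join a n) v).
Proof.
have E2 (n : 'I_m -> N) (a : 'I_k -> N) :
    @sat _ (pair_structure P) _ (Fand (fren inr (all_pred (enum 'I_k)))
       (flift (fren (join (join inr (inl \o inr)) (inl \o inl)) R2)))
       (join (join v n) a) <->
    (forall i, P (a i)) /\ sat R2 (join (join a n) v).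
  rewrite /= sat_fren sat_all_pred sat_flift sat_fren !comp_join.
  by split=> -[H1 H2]; split=> // i; apply: H1; rewrite mem_enum.
have E1 (n : 'I_m -> N) :
    @sat _ (pair_structure P) _ (Fand (fren inr (all_pred (enum 'I_m)))
       (flift (fren (join inr inl) R1))) (join v n) <->
    (forall i, P (n i)) /\ sat R1 (join n v).
  rewrite /= sat_fren sat_all_pred sat_flift sat_fren !comp_join.
  by split=> -[H1 H2]; split=> // i; apply: H1; rewrite mem_enum.
rewrite /rel_forall_exists sat_Fnot sat_Fexn; split=> [H n Pn R1n|H [n]].
  apply: contrapT => na; apply: H; exists n; rewrite sat_Fand sat_Fnot sat_Fexn E1.
  by split=> // -[a /E2 Ha]; apply: na; exists a.
rewrite sat_Fand sat_Fnot sat_Fexn E1 => -[[Pn R1n]]; apply.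
by have [a Ha] := H n Pn R1n; exists a; apply/E2.
Qed.
End PairFormulas.

(** * Types over M in the pair extension, and the invariant extension to N' *)

Section PairExtension.
Variables (kappa : Type) (L : language) (U : structure L) (M : set U).
Variables (N' : structure L) (N : set N') (j : U -> N').
Hypothesis satU : saturated (fun A : set U => small kappa A).
Hypothesis smM : small kappa M.
Hypothesis HM : elem_substructure M.
Hypothesis pairE :
  @elementary (lang_pred L) (pair_structure M) (pair_structure N) j.

(** The parameters from [U] are kept as free variables, assigned by [id] in [U] and by [j] in [N'];
    elementarity of [j] then compares a single formula. *)
Lemma pair_transfer (m k : nat) (R1 : formula L ('I_m + U))
    (R2 : formula L (('I_k + 'I_m) + U)) :
  (forall n : 'I_m -> U, (forall i, M (n i)) -> sat R1 (join n id) ->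
    exists a : 'I_k -> U, (forall i, M (a i)) /\ sat R2 (join (join a n) id)) ->
  forall n : 'I_m -> N', (forall i, N (n i)) -> sat R1 (join n j) ->
    exists a : 'I_k -> N', (forall i, N (a i)) /\ sat R2 (join (join a n) j).
Proof.
move=> H; apply: (iffLR (sat_rel_forall_exists N R1 R2 j)).
apply: (iffLR (pairE (rel_forall_exists R1 R2) id)).
exact: (iffRL (sat_rel_forall_exists M R1 R2 id)).
Qed.

Lemma pair_elementary : elementary j.
Proof.
move=> V phi v; have := pairE (flift phi) v.
by rewrite (sat_flift M) (sat_flift N).
Qed.

Lemma pair_pred u : M u -> N (j u).
Proof.
move=> Mu; have [/(_ _)+ _] := pairE (all_pred L [:: tt]) (fun=> u).
by rewrite !sat_all_pred => H; apply: (H _ tt); rewrite ?inE.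
Qed.

(* [c] and [n] have the same type over [M], identified with [j @` M]. *)
Definition sim (V : Type) (c : V -> U) (n : V -> N') :=
  forall (P : finType) (psi : formula L (V + P)) (e : P -> U),
    (forall i, M (e i)) -> (sat psi (join c e) <-> sat psi (join n (j \o e))).

Lemma sim_pre (V W : Type) (h : W -> V) (c : V -> U) (n : V -> N') :
  sim c n -> sim (c \o h) (n \o h).
Proof.
move=> cn P psi e Me; have := cn P (fren (join (inl \o h) inr) psi) e Me.
by rewrite !sat_fren !comp_join.
Qed.

Lemma sim_sat (V : Type) (c : V -> U) (n : V -> N') (phi : formula L V) :
  sim c n -> (sat phi c <-> sat phi n).
Proof.
move=> cn; have := cn void (fren inl phi) (of_void U).
by rewrite !sat_fren; apply; case.
Qed.

Lemma sim_self (V : Type) (c : V -> U) : sim c (j \o c).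
Proof. by move=> P psi e Me; rewrite -comp_join; exact: pair_elementary. Qed.

Lemma sim_eqv (V : Type) (c c' : V -> U) (n : V -> N') :
  sim c n -> sim c' n -> eqv M c c'.
Proof.
by move=> cn cn' X [P [psi [e [Me HX]]]]; rewrite !HX (cn _ _ _ Me) (cn' _ _ _ Me).
Qed.

Lemma sim_equiv_over m (c : 'I_m -> U) (n : 'I_m -> N') :
  sim c n -> equiv_over (j @` M) n (j \o c).
Proof.
move=> cn _ [l [psi [e' [Me' ->]]]]; rewrite !holds_inst.
have /choice[e He] i : exists u, M u /\ j u = e' i.
  by have [u] := Me' i; exists u.
have -> : e' = j \o e by apply: funext => i; rewrite /= (He i).2.
have Me i : M (e i) := (He i).1.
by rewrite -(cn _ _ _ Me) (sim_self c _ Me).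
Qed.

Lemma equiv_over_sim m (c : 'I_m -> U) (n n' : 'I_m -> N') :
  equiv_over (j @` M) n n' -> sim c n -> sim c n'.
Proof.
move=> /equiv_overP nn' cn P psi e Me; rewrite (cn _ _ _ Me).
apply: (nn' (fun v => sat psi (join v (j \o e)))).
by exists P, psi, (j \o e); split=> // i; exists (e i).
Qed.

Lemma sim_over m (c : 'I_m -> U) (n : 'I_m -> N') (phi : formula L ('I_m + U)) :
  sim c n -> over M phi -> (holds phi c <-> sat phi (join n j)).
Proof.
move=> s [l [psi [e [Me ->]]]]; rewrite holds_inst (s _ _ _ Me) /inst sat_fren.
suff -> : join n (j \o e) = join n j \o
  (fun s => match s with inl i => inl i | inr i => inr (e i) end) by [].
by apply: funext; case.
Qed.

Lemma over_Fand (S : structure L) (A : set S) n (phi psi : formula L ('I_n + S)) :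
  over A phi -> over A psi -> over A (Fand phi psi).
Proof.
move=> [m1 [psi1 [d1 [A1 ->]]]] [m2 [psi2 [d2 [A2 ->]]]].
pose psi12 : formula L ('I_n + ('I_m1 + 'I_m2)) := Fand
  (fren (join inl (inr \o inl)) psi1) (fren (join inl (inr \o inr)) psi2).
have := @over_fren _ _ A n _ psi12 (join d1 d2).
by rewrite /= !fren_comp !comp_join; apply; case.
Qed.

(** The type of [n] over [M] is finitely satisfiable in [U] because [j] is elementary, and [U] is
    saturated over the small set [M]. *)
Lemma sim_ex (V : finType) (n : V -> N') : exists c, sim c n.
Proof.
pose n' : 'I_#|V| -> N' := n \o enum_val.
pose S := [set phi : formula L ('I_#|V| + U) | over M phi /\ sat phi (join n' j)].
have [||c Hc] := satU smM (S := S); first by move=> phi [].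
  apply: fin_sat_in_directed.
  - have [u0 Mu0] := elem_substructure_nonempty HM.
    exists (Feq (Tvar (inr u0)) (Tvar (inr u0))); split=> //.
    pose tau : formula L ('I_#|V| + 'I_1) := Feq (Tvar (inr ord0)) (Tvar (inr ord0)).
    by exists 1%N, tau, (fun=> u0).
  - move=> phi psi [H1 H2] [H3 H4]; exists (Fand phi psi); split=> //.
    by split=> //; exact: over_Fand.
  - move=> phi [_ H].
    have : sat (Fexn (fren (join inr inl) phi)) (j \o id).
      by apply/sat_Fexn; exists n'; rewrite sat_fren comp_join.
    move=> /pair_elementary/sat_Fexn[a]; rewrite sat_fren comp_join.
    by exists a.
exists (c \o enum_rank) => P psi e Me.
pose phi : formula L ('I_#|V| + U) :=
  fren (join inl (inr \o e)) (fren (join (inl \o enum_rank) inr) psi).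
have EU : holds phi c = sat psi (join (c \o enum_rank) e).
  by rewrite /holds !sat_fren !comp_join.
have EN : sat phi (join n' j) = sat psi (join n (j \o e)).
  rewrite !sat_fren; congr (sat psi _); apply: funext; case=> i //=.
  by rewrite /n' /= enum_rankK.
rewrite -EU -EN; split=> [H|H]; last by apply: Hc; split=> //; exact: over_fren.
apply: contrapT => nH; apply: (Hc (Fnot phi)) H; split=> //.
exact: (@over_fren _ _ _ _ _ (Fnot _)).
Qed.

Section InvariantExtension.
Variable k : nat.
Variable r : set (formula L ('I_k + U)).
Hypotheses (cr : complete_type r) (ir : invariant M r).

(** The extension forced by invariance: a tuple [n] is replaced by a tuple [c] of [U] with the same
    type over [M]. Since [inv_restr] gathers all invariant extensions, [rext_inv_extension] and
    [inv_extension_sub] together identify r|_N with the part of [rext] over [N]. *)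
Definition rext : set (formula L ('I_k + N')) :=
  [set Phi | exists (m : nat) (psi : formula L ('I_k + 'I_m)) (n : 'I_m -> N')
     (c : 'I_m -> U), [/\ Phi = inst psi n, sim c n & r (inst psi c)]].

(** One tuple [c] imitates n1, n2, n3 jointly; invariance moves each instance of [r] to it, and the
    entailment is a first-order property of the joint tuple. This yields both independence of the
    representation and closure of [rext] under conjunction. *)
Lemma inst_sim3 (m1 m2 m3 : nat) (psi1 : formula L ('I_k + 'I_m1))
    (psi2 : formula L ('I_k + 'I_m2)) (psi3 : formula L ('I_k + 'I_m3))
    (n1 : 'I_m1 -> N') (n2 : 'I_m2 -> N') (n3 : 'I_m3 -> N') c1 c2 c3 :
  sim c1 n1 -> sim c2 n2 -> sim c3 n3 ->
  (forall a, sat psi1 (join a n1) -> sat psi2 (join a n2) -> sat psi3 (join a n3)) ->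
  r (inst psi1 c1) -> r (inst psi2 c2) -> r (inst psi3 c3).
Proof.
move=> s1 s2 s3 H.
pose n := join (join n1 n2) n3; have [c cn] := sim_ex n.
have move_r m (psi : formula L ('I_k + 'I_m)) (h : 'I_m -> 'I_m1 + 'I_m2 + 'I_m3) d :
    sim d (n \o h) -> (r (inst psi d) <-> r (inst psi (c \o h))).
  by move=> sd; apply: ir; apply/equiv_overP; exact: sim_eqv sd (sim_pre h cn).
rewrite (move_r _ _ (inl \o inl) _ s1) (move_r _ _ (inl \o inr) _ s2).
rewrite (move_r _ _ inr _ s3) !(mostE cr) => r1 r2.
apply: most_mono (most_and cr r1 r2) => a [].
rewrite !holds_inst => H1 H2; apply: contrapT => H3.
pose g m (h : 'I_m -> 'I_m1 + 'I_m2 + 'I_m3) := join inr (inl \o h) :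
  'I_k + 'I_m -> 'I_m1 + 'I_m2 + 'I_m3 + 'I_k.
have : sat (Fexn (Fand (fren (g _ (inl \o inl)) psi1)
  (Fand (fren (g _ (inl \o inr)) psi2) (Fnot (fren (g _ inr) psi3))))) c.
  by apply/sat_Fexn; exists a; rewrite /= !sat_fren !comp_join.
move=> /(sim_sat _ cn)/sat_Fexn[b /=]; rewrite !sat_fren !comp_join.
by move=> [B1 [B2 B3]]; apply: B3; apply: H.
Qed.

Lemma rextE m (psi : formula L ('I_k + 'I_m)) n c :
  sim c n -> (rext (inst psi n) <-> r (inst psi c)).
Proof.
move=> s; split=> [[m1 [psi1 [n1 [c1 [E s1 r1]]]]]|H]; last by exists m, psi, n, c.
by apply: (inst_sim3 s1 s1 s _ r1 r1) => a; rewrite -!holds_inst -E.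
Qed.

Lemma rext_inv_extension : inv_extension M j r rext.
Proof.
split.
- apply: complete_type_directed => [phi psi|phi|phi].
  + move=> [m1 [psi1 [n1 [c1 [-> s1 r1]]]]] [m2 [psi2 [n2 [c2 [-> s2 r2]]]]].
    have [m3 [psi3 [n3 [_ E]]]] := over_setT (Fand (inst psi1 n1) (inst psi2 n2)).
    have [c3 s3] := sim_ex n3.
    exists (inst psi3 n3); split; last by rewrite -E.
    exists m3, psi3, n3, c3; split=> //.
    apply: (inst_sim3 s1 s2 s3) r1 r2 => a; rewrite -!holds_inst -E.
    by move=> H1 H2; split.
  + move=> [m [psi [n [c [-> s /(mostE cr)/(most_ex cr)[a]]]]]].
    rewrite holds_inst => H.
    have : sat (Fexn (fren (join inr inl) psi)) c.
      by apply/sat_Fexn; exists a; rewrite sat_fren comp_join.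
    move=> /(sim_sat _ s)/sat_Fexn[b]; rewrite sat_fren comp_join.
    by exists b; rewrite holds_inst.
  + have [m [psi [n [_ ->]]]] := over_setT phi; have [c s] := sim_ex n.
    have [H|H] := cr.2 (inst psi c); [left|right].
      by exists m, psi, n, c.
    by exists m, (Fnot psi), n, c.
- move=> phi; have [m [psi [c [_ ->]]]] := over_setT phi => H.
  exists m, psi, (j \o c), c; split=> //; last exact: sim_self.
  by rewrite /push /inst fren_comp; congr fren; apply: funext; case.
- move=> m psi b c bc; have [b0 s] := sim_ex b; have s' := equiv_over_sim bc s.
  by rewrite (rextE _ s) (rextE _ s').
Qed.

Lemma inv_extension_sub r' : inv_extension M j r r' -> r' `<=` rext.
Proof.
move=> [cr' ext inv'] phi; have [m [psi [n [_ ->]]]] := over_setT phi.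
have [c s] := sim_ex n; rewrite (inv' _ _ _ _ (sim_equiv_over s)) => H.
exists m, psi, n, c; split=> //; have [//|/ext nH] := cr.2 (inst psi c).
have Ep (chi : formula L ('I_k + 'I_m)) : push j (inst chi c) = inst chi (j \o c).
  by rewrite /push /inst fren_comp; congr fren; apply: funext; case.
have nH' : r' (inst (Fnot psi) (j \o c)) by rewrite -Ep.
by have [a [H1 []]] := complete_ex3 cr' H nH' nH'.
Qed.

End InvariantExtension.
End PairExtension.

(** * The maps F_M and K_M on definable types *)

Section Retraction.
Variables (kappa : Type) (L : language) (U : structure L) (M : set U).
Variables (N' : structure L) (N : set N') (j : U -> N').
Variable T : set (sentence L).
Hypothesis smN : small kappa [set: nat].
Hypothesis satU : saturated (fun A : set U => small kappa A).
Hypothesis smM : small kappa M.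
Hypothesis HM : elem_substructure M.
Hypothesis pairE :
  @elementary (lang_pred L) (pair_structure M) (pair_structure N) j.
Hypothesis TU : model_of T U.
Hypothesis HNIP : NIP T.
Variable k : nat.
Implicit Types (p q r s : set (formula L ('I_k + U))) (X Y : ('I_k -> U) -> Prop).

Lemma holds_push (phi : formula L ('I_k + U)) a :
  holds (push j phi) a = sat phi (join a j).
Proof. by rewrite /holds /push sat_fren; congr sat; apply: funext; case. Qed.

Lemma over_push A (phi : formula L ('I_k + U)) :
  over A phi -> over (j @` A) (push j phi).
Proof.
move=> [m [psi [d [Ad ->]]]]; exists m, psi, (j \o d); split=> [i|].
  by exists (d i).
by rewrite /push /inst fren_comp; congr fren; apply: funext; case.
Qed.

Lemma over_sub (A B : set N') n (phi : formula L ('I_n + N')) :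
  A `<=` B -> over A phi -> over B phi.
Proof.
move=> AB [m [psi [d [Ad ->]]]]; exists m, psi, d.
by split=> // i; apply: AB.
Qed.

Section Definable.
Variable r : set (formula L ('I_k + U)).
Hypotheses (cr : complete_type r) (dr : definable_over M r).

Lemma coheir_ex X : coheir M r X -> exists a, (forall i, M (a i)) /\ X a.
Proof.
move=> [chi [Dchi mchi H]].
have [a [Ma chia]] := Tarski_Vaught HM Dchi (most_ex cr mchi).
by exists a; split=> //; apply: H.
Qed.

Lemma coheir_and X Y : coheir M r X -> coheir M r Y ->
  coheir M r (fun a => X a /\ Y a).
Proof.
move=> [chi [D1 m1 H1]] [chi' [D2 m2 H2]].
exists (fun a => chi a /\ chi' a); split; first exact: Def_and.
  exact: most_and.
by move=> a Ma [/(H1 _ Ma) ? /(H2 _ Ma)].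
Qed.

Lemma most_coheir X : Def M X -> (coheir M r X <-> most r X).
Proof.
move=> DX; split=> [[chi [Dchi mchi H]]|mX]; last by exists X.
by apply: most_mono mchi; apply: (Tarski_Vaught_all HM (Def_imp Dchi DX)).
Qed.

(* For definable [r], that theta meets in N every formula of r|_N is expressed
   by first-order sentences of the pair, so it can be checked in (U, M). *)
Lemma F_mapE theta : F_map M N j r theta <-> coheir M r (holds theta).
Proof.
have ir := definable_invariant dr.
have extE := rext_inv_extension satU smM HM pairE cr ir.
split=> [H|[chi [Dchi mchi Hchi]]].
  (* Were theta not in the filter, NIP would put its complement there, with a trace [phi] in the
     restriction of [r] to [M]. *)
  have [//|[chi [/Def_over[phi [Mphi Hphi]] mchi Hchi]]] :=
    coheir_decides smN satU smM HM cr dr TU HNIP (Def_holds theta).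
  have rphi : inv_restr M N j r (push j phi).
    exists (rext M j r); split=> //; split.
      case: extE => _ + _; apply; apply/(mostE cr).
      by apply: most_mono mchi => a; rewrite Hphi.
    apply: over_sub (over_push Mphi) => _ [u Mu <-].
    exact: (pair_pred pairE).
  have [||a [Na Ha]] := H [set push j theta; push j phi]; first exact: finite_set2.
    by move=> _ [->|->]; [left|right].
  have : holds (push j theta) a by apply: Ha; left.
  have : holds (push j phi) a by apply: Ha; right.
  rewrite !holds_push => aphi atheta.
  (* With an empty existential block, the transferred statement says that no point of [N] satisfying
     [phi] satisfies theta. *)
  pose R2 : formula L (('I_0 + 'I_k) + U) := Fnot (fren (join (inl \o inr) inr) theta).
  have [n Mn Hn|b [_]] := pair_transfer pairE (R1 := phi) (R2 := R2) _ Na aphi.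
    have [u0] := carrier_inhabited U; exists (fun=> u0); split; first by case.
    rewrite sat_Fnot sat_fren comp_join => Ht.
    by apply: (Hchi n Mn) Ht; apply/Hphi.
  by rewrite sat_Fnot sat_fren comp_join.
move=> S0 finS0 S0sub.
(* The finite part of r|_N is compressed into one formula, so that a single definition [delta]
   suffices below. *)
have dir : exists Phi, [/\ rext M j r Phi, over N Phi &
    forall a, holds Phi a -> holds (push j theta) a -> realizes a S0].
  pose Q Phi := rext M j r Phi /\ over N Phi; pose Ix := {Phi | Q Phi}.
  pose P (Phi : Ix) phi := forall a, holds (sval Phi) a ->
    holds (push j theta) a -> holds phi a.
  have [u0 Mu0] := elem_substructure_nonempty HM.
  pose tau : formula L ('I_k + 'I_1) := Feq (Tvar (inr ord0)) (Tvar (inr ord0)).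
  have o0 : over M (inst tau (fun=> u0)) by exists 1%N, tau, (fun=> u0).
  have MN (phi : formula L ('I_k + U)) : over M phi -> over N (push j phi).
    move=> ophi; apply: over_sub (over_push ophi) => _ [u Mu <-].
    exact: (pair_pred pairE).
  have i0 : rext M j r (push j (inst tau (fun=> u0))) /\
      over N (push j (inst tau (fun=> u0))).
    split; last exact: MN.
    case: extE => _ + _; apply; apply/(mostE cr).
    by apply: most_mono (iffRL (most_cst cr True) I) => a; rewrite holds_inst.
  have [||[Phi [e o]] HPhi] := @finite_set_directed _ Ix P (exist Q _ i0) S0 _ finS0.
  - move=> [Phi1 [e1 o1]] [Phi2 [e2 o2]].
    have e3 : rext M j r (Fand Phi1 Phi2).
      by case: extE => ce _ _; exact: complete_and.
    exists (exist Q _ (conj e3 (over_Fand o1 o2))) => phi [] H a /= [a1 a2];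
      exact: H.
  - move=> phi /S0sub[->|[r' [er' [r'phi oN]]]].
      by exists (exist Q _ i0) => a.
    have e' := inv_extension_sub satU smM HM pairE cr er' r'phi.
    by exists (exist Q _ (conj e' oN)) => a.
  by exists Phi; split=> // a aPhi at_ phi /HPhi; apply.
have {dir}[Phi [rPhi [m [psi [n [Nn E]]]] HPhi]] := dir.
have [delta [Mdelta Hdelta]] := dr psi.
have [c sc] := sim_ex satU smM HM pairE n.
have dn : sat delta (join n j).
  apply/(sim_over sc Mdelta)/Hdelta/(rextE satU smM HM pairE cr ir psi sc).
  by rewrite -E.
(* To be checked in (U, M): if [b] in [M] satisfies [delta], then psi(x, b) and [chi] are both in
   [r], hence have a common point in [M], and theta holds there. *)
pose R2 : formula L (('I_k + 'I_m) + U) :=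
  Fand (fren inl psi) (fren (join (inl \o inl) inr) theta).
have [b Mb /Hdelta Hb|a [Na]] := pair_transfer pairE (R1 := delta) (R2 := R2) _ Nn dn.
  have Dpsi : Def M (fun a => sat psi (join a b)).
    exact: (Def_par Mb (Def_sat M psi)).
  have mpsi : most r (fun a => sat psi (join a b)).
    move: Hb; rewrite (mostE cr); apply: most_mono => a.
    by rewrite holds_inst.
  have [a [Ma [a1 a2]]] := Tarski_Vaught HM (Def_and Dpsi Dchi)
    (most_ex cr (most_and cr mpsi mchi)).
  exists a; split=> //; rewrite sat_Fand !sat_fren comp_join; split=> //.
  exact: Hchi.
rewrite sat_Fand !sat_fren comp_join => -[a1 a2]; exists a; split=> //.
apply: HPhi; first by rewrite E holds_inst.
by rewrite holds_push.
Qed.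
End Definable.

(** * The map K_M on right dfg types *)

Variable G : definable_group U k.

Local Notation "p ** q" := (newelski G M p q) (at level 40).
Local Notation "p .* c" := (rtranslate G p c) (at level 40).
Local Notation gm := (gm G).
Local Notation gi := (gi G).
Local Notation K := (K_map M N j G).

Section TypeInverse.
Variable p : set (formula L ('I_k + U)).
Hypothesis Sp : S_G G p.

Lemma type_invE phi : type_inv G p phi <-> most p (fun a => holds phi (gi a)).
Proof.
rewrite /type_inv /= (mostE Sp.1) (most_iff _ (subst_invE G _)).
exact: most_invX.
Qed.

Lemma Def_gi A X : Def A X ->
  exists Y, Def A Y /\ forall a, inG G a -> (Y a <-> X (gi a)).
Proof.
move=> DX; exists (invX G X); split; last by move=> a Ga; exact: invXE.
have := Def_pre (inl : 'I_k -> 'I_k + void) DX.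
by move=> /(Def_invX G (id : 'I_k -> 'I_k) (of_void _)).
Qed.

Lemma type_inv_complete : complete_type (type_inv G p).
Proof. by apply: (complete_push Sp) type_invE => X DX; exact: Def_gi. Qed.

Lemma most_type_inv X : Def setT X ->
  (most (type_inv G p) X <-> most p (fun a => X (gi a))).
Proof. by move=> DX; apply: (most_push type_invE DX); exact: type_inv_complete. Qed.

Lemma type_inv_definable : definable_over M p -> definable_over M (type_inv G p).
Proof.
move=> dp n phi.
have D := Def_invX G (inl : 'I_k -> 'I_k + 'I_n) inr (Def_sat M phi).
have /Def_over[psi [Mpsi Hpsi]] := Def_most Sp.1 dp D.
exists psi; split=> // b; rewrite -Hpsi type_invE -(most_invX Sp).
by apply: (most_onG Sp) => a Ga; rewrite !invXE // holds_inst.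
Qed.
End TypeInverse.

Section OneType.
Variable p : set (formula L ('I_k + U)).
Hypotheses (Sp : S_G G p) (dp : definable_over M p).

Let ci := type_inv_complete Sp.
Let di := type_inv_definable Sp dp.

Lemma K_mapE theta : K p theta <-> coheir M (type_inv G p) (holds theta).
Proof. exact: F_mapE. Qed.

Lemma K_complete : complete_type (K p).
Proof.
apply: complete_type_directed => [phi psi|phi|phi].
- move=> /K_mapE H1 /K_mapE H2; exists (Fand phi psi); split=> //.
  exact/K_mapE/(coheir_and ci H1 H2).
- by move=> /K_mapE/(coheir_ex ci)[a [_]]; exists a.
- rewrite !K_mapE; have D := Def_holds phi.
  exact: (coheir_decides smN satU smM HM ci di TU HNIP D).
Qed.

Lemma K_most X : Def setT X -> coheir M (type_inv G p) X -> most (K p) X.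
Proof.
move=> /Def_over[phi [_ HX]] [chi [Dchi mchi H]].
exists phi; split; last by move=> a /HX.
by apply/K_mapE; exists chi; split=> // a Ma /(H a Ma)/HX.
Qed.

Lemma K_most_model X : Def M X -> (most (K p) X <-> most p (fun a => X (gi a))).
Proof.
move=> DX; have DXT : Def setT X by apply: Def_sub DX.
rewrite -(most_type_inv Sp DXT) -(most_coheir (type_inv G p) DX).
split=> [[phi [Kphi HX]]|]; last exact: K_most.
have [chi [Dchi mchi H]] := iffLR (K_mapE phi) Kphi.
by exists chi; split=> // a Ma /(H a Ma)/HX.
Qed.

Lemma K_S_fs : S_fs G M (K p).
Proof.
have SK : S_G G (K p).
  apply: S_G_of K_complete _; apply/K_most_model; first exact: Def_sat.
  by apply: most_mono (S_G_most Sp) => a; exact: gi_inG.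
split=> //; apply: fin_sat_in_directed.
- by exists (fren inl (gdom G)); exact: SK.2.
- move=> phi psi H1 H2; exists (Fand phi psi); split=> //.
  exact: (complete_and K_complete).
- by move=> phi /K_mapE/(coheir_ex ci).
Qed.
End OneType.

(* Both sides are finitely satisfiable in [M], so by uniqueness of coheirs it
   suffices to compare them over [M]. *)
Lemma newelski_K s p g : S_fs G M s -> rdfg M G p -> rz s M g ->
  s ** K p = K (p .* gi g).
Proof.
move=> Ss dfp rg; have Sp := dfp.1; have dp := dfp.2.1.
have Gg := rz_inG Ss.1 rg; have Gi := gi_inG Gg.
have dfpg := rdfg_rtranslate dfp Gi; have Spg := dfpg.1; have dpg := dfpg.2.1.
have SK := K_S_fs Sp dp; have SsK := newelski_S_fs smN satU smM HM Ss SK.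
have [Ss' SK'] := (S_fs_S_inv Ss, S_fs_S_inv SK).
have cpg := K_complete Spg dpg.
apply/esym; apply: (complete_type_eq cpg SsK.1.1) => theta.
move=> /(K_mapE Spg dpg)[chi [Dchi mchi Hchi]].
have DchiT : Def setT chi by apply: Def_sub Dchi.
(* On [M], [chi] implies theta; a type finitely satisfiable in [M] that contains [chi] cannot omit
   theta. *)
suff mX : most (s ** K p) chi.
  have [//|nt] := SsK.1.1.2 theta.
  have := most_and SsK.1.1 mX (iffLR (mostE SsK.1.1 _) nt).
  move=> /(fin_sat_ex SsK.1.1 SsK.2)[a [Ma [chia]]].
  by case; exact: Hchi.
(* [Psi] is M-definable since p^-1 is, so [s] can test it at [g], where g.x^-1 = (x.g^-1)^-1 turns
   it into membership of [chi] in the inverse of p.g^-1. *)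
pose Psi (z : 'I_k -> U) := most (type_inv G p) (fun y => mulX G chi z y).
have Dmul : Def M (fun w : 'I_k + 'I_k -> U => mulX G chi (w \o inr) (w \o inl)).
  have := Def_pre (inl : 'I_k -> 'I_k + void) Dchi.
  by move=> /(Def_mulX G (inr : 'I_k -> 'I_k + 'I_k) inl (of_void _)).
have DPsi : Def M Psi.
  exact: (Def_most (type_inv_complete Sp) (type_inv_definable Sp dp) Dmul).
have Dz z : Def setT (fun y => mulX G chi z y).
  by apply: (Def_par (d := z)) (Def_sub _ Dmul).
have sPsi : most s Psi.
  apply/(rzP Ss.1.1 rg DPsi); rewrite /Psi (most_type_inv Sp (Dz _)).
  move: mchi; rewrite (most_type_inv Spg DchiT).
  have [Y [DY HY]] := Def_gi DchiT.
  rewrite -(most_onG Spg HY) (most_rtranslate Sp Gi DY).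
  apply: (iffLR (most_onG Sp _)) => a Ga; have Gai := gi_inG Ga.
  by rewrite HY ?mulXE ?gi_gm ?gi_gi //; exact: gm_inG.
have [b rb] := rz_model satU smM SK.1.1; have Gb := rz_inG SK.1 rb.
rewrite (most_newelski_model smN satU smM HM Ss' SK' Dchi rb).
(* The exchange: a failure would occur at some [a] in [M] satisfying [Psi]; there chi(a.y) is an
   M-formula of p^-1, hence of K p, and [b] must satisfy it. *)
apply: contrapT => /(most_gm_not Ss.1 Gb Dchi) H.
have := most_and Ss.1.1 (S_G_most Ss.1) (most_and Ss.1.1 sPsi H).
move=> /(fin_sat_ex Ss.1.1 Ss.2)[a [Ma [Ga [Psia]]]]; apply.
apply/mulXE => //; have Da := Def_par Ma Dmul; apply: (rb _ Da).
apply/(K_most_model Sp dp Da).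
by rewrite -(most_type_inv Sp (Dz a)).
Qed.

(** With [c] realizing [q] over [M], p * q is p.c, while K q is realized over [M] by c^-1; this is
    [newelski_K] for s = K q and g = c^-1. *)
Lemma K_newelski p q : rdfg M G p -> rdfg M G q -> K (p ** q) = K q ** K p.
Proof.
move=> dfp dfq; have Sq := rdfg_S_inv dfq.
have [c rc] := rz_model satU smM Sq.1.1; have Gc := rz_inG Sq.1 rc.
rewrite (newelski_rdfg smN satU smM HM dfp Sq rc).
rewrite (@newelski_K _ _ (gi c)) ?gi_gi //.
  exact: (K_S_fs dfq.1 dfq.2.1).
move=> X DX /(K_most_model dfq.1 dfq.2.1 DX).
have [Y [DY HY]] := Def_gi DX.
by rewrite -(most_onG dfq.1 HY) => mY; apply/HY => //; exact: (rc _ DY).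
Qed.

Lemma K_inj p q : rdfg M G p -> rdfg M G q -> K p = K q -> p = q.
Proof.
move=> dfp dfq E; have [[Sp [dp _]] [Sq [dq _]]] := (dfp, dfq).
have EM X : Def M X -> (most p X <-> most q X).
  move=> DX; have [Y [DY HY]] := Def_gi DX.
  have HX a : inG G a -> (Y (gi a) <-> X a).
    by move=> Ga; rewrite HY ?gi_gi //; exact: gi_inG.
  rewrite -(most_onG Sp HX) -(most_onG Sq HX).
  by rewrite -(K_most_model Sp dp DY) -(K_most_model Sq dq DY) E.
apply: (complete_type_eq Sp.1 Sq.1) => phi.
have [n [psi [d [_ ->]]]] := over_setT phi.
have D := Def_sat M psi.
(* Both definitions of psi are M-definable, so an implication checked at parameters from [M] holds
   at all parameters. *)
have DI := Def_imp (Def_most Sp.1 dp D) (Def_most Sq.1 dq D).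
have inE r b : most r (fun a => sat psi (join a b)) <-> most r (holds (inst psi b)).
  by apply: most_iff => a; rewrite holds_inst.
rewrite (mostE Sp.1) (mostE Sq.1) -!inE; apply: (Tarski_Vaught_all HM DI) => b Mb.
by rewrite EM //; exact: (Def_par Mb D).
Qed.

End Retraction.

Theorem theorem4p21 (kappa : Type) (L : language) (T : set (sentence L))
    (U : structure L) (HU : monster_model kappa T U)
    (M : set U) (HM : elem_substructure M) (HMsmall : small kappa M)
    (k : nat) (G : definable_group U k)
    (N' : structure L) (N : set N') (j : U -> N')
    (HN : saturated_pair_extension M N j)
    (HNIP : NIP T) (Hdfg : dfg_group G M)
    (t : set (formula L ('I_k + U)))
    (Ht : S_inv G M t) (Htdfg : right_dfg G M t) :
  let tS := [set newelski G M t q | q in S_inv G M] in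
  [/\ ellis_subgroup (newelski G M) (S_inv G M) tS,
      ellis_subgroup (newelski G M) (S_fs G M) (K_map M N j G @` tS) &
      anti_isomorphism (newelski G M) tS (K_map M N j G @` tS)
        (K_map M N j G)].
Proof.
case: HU => smN _ _ TU satU _; have [pairE _] := HN.
have dt : rdfg M G t by split; first exact: Ht.1.
have [a0 ra0] := rz_model satU HMsmall Ht.1.1.
rewrite /= (newelski_orbit_image smN satU HMsmall HM dt ra0).
have Odfg := orbit_rdfg dt.
have Kmul p q (Op : orbit G t p) (Oq : orbit G t q) :=
  K_newelski smN satU HMsmall HM pairE TU HNIP (Odfg p Op) (Odfg q Oq).
have Ou := orbit_unit dt ra0.
have mul1 := orbit_mul1p smN satU HMsmall HM dt ra0.
have mulr1 := orbit_mulp1 smN satU HMsmall HM dt ra0.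
split.
- exact: (orbit_ellis smN satU HMsmall HM dt ra0).
- apply: (@ellis_left_ideal _ _ _ _ (K_map M N j G (rtranslate G t (gi G a0)))).
  + move=> _ [p Op <-]; have [Sp [dp _]] := Odfg p Op.
    exact: (K_S_fs smN satU HMsmall HM pairE TU HNIP Sp dp).
  + by exists (rtranslate G t (gi G a0)).
  + by move=> _ [p Op <-]; rewrite -Kmul // mulr1.
  + by move=> _ [p Op <-]; rewrite -Kmul // mul1.
  + move=> _ [p Op <-].
    have [q [Oq _ pq]] := orbit_inv smN satU HMsmall HM dt ra0 Op.
    by exists (K_map M N j G q); [exists q|rewrite -Kmul // pq].
  + move=> s _ Ss [p Op <-]; have [g rg] := rz_model satU HMsmall Ss.1.1.
    rewrite (newelski_K smN satU HMsmall HM pairE TU HNIP Ss (Odfg p Op) rg).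
    exists (rtranslate G p (gi G g)) => //; apply: (orbit_rtranslate dt) => //.
    exact: gi_inG (rz_inG Ss.1 rg).
- split; last by move=> p q Op Oq; exact: Kmul.
  split=> // p q.
  rewrite !inE => Op Oq.
  exact: (K_inj smN satU HMsmall HM pairE TU HNIP (Odfg p Op) (Odfg q Oq)).
Qed.
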